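(* Let $M=D^2\times S^1$ be the solid flat torus and let $\eta(t)$ be the geodesic on $\mathcal{D}_{\mu,E}(M)$ with initial conditions $\eta(0)=\mathrm{id}$ and $\dot\eta(0)=X=u(r)\,\partial_\theta$. Let $\omega(r)=2u(r)+ru'(r)$ denote the vorticity function of $X$, and assume that $u(r)\omega(r)>0$ for all $r\in[0,1]$. Then $\eta(t)$ is a monoconjugate point to $\eta(0)$ along $\eta$ for every time $t=2\pi\lambda/n$, where $n\in\mathbb{N}=\{1,2,3,\dots\}$ is arbitrary and $\lambda$ is any eigenvalue of the Bessel-type Sturm–Liouville problem $$\frac1r\,\frac{d}{dr}\big(r\psi'(r)\big)-\Big(n^2+\frac1{r^2}\Big)\psi(r)=-2\lambda^2u(r)\omega(r)\psi(r),\qquad \psi(1)=0,\quad \psi(0)\text{ finite},$$ i.e. any real $\lambda$ for which this problem has a solution $\psi$ on $(0,1]$ that is not identically zero.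
   Context: $M=D^2\times S^1$, where $D^2\subset\mathbb{R}^2$ is the closed unit disk and $S^1=\mathbb{R}/2\pi\mathbb{Z}$, has the flat metric $dr^2+r^2d\theta^2+dz^2$ in cylindrical coordinates ($0\le r\le 1$, $\theta$ and $z$ being $2\pi$-periodic), with volume form $\mu=r\,dr\,d\theta\,dz$. All vector fields are smooth; in particular $u$ is a real function such that $X=u(r)\partial_\theta$ is smooth on $M$. $\mathcal{D}_\mu(M)$ is the group of volume-preserving diffeomorphisms of $M$ with the weak $L^2$ Riemannian metric, whose tangent space at the identity consists of divergence-free fields tangent to $\partial M$, with inner product $\langle\!\langle V,W\rangle\!\rangle=\int_M\langle V,W\rangle\,\mu$. Its geodesics are the flows of solutions of the incompressible Euler equations. $\mathcal{D}_{\mu,E}(M)$ is the totally geodesic submanifold of those volume-preserving diffeomorphisms commuting with the flow of $E=\partial_\theta$; its tangent space at the identity consists of divergence-free fields $Y$ tangent to $\partial M$ with $[E,Y]=0$. The field $X=u(r)\partial_\theta$ is a steady Euler solution, so $\eta(t)$ is its flow. For a vector field $V$, $P(V)=V-\nabla q$ is the projection onto the divergence-free part, where $q$ solves $\Delta q=\operatorname{div}V$ in $M$, $\langle\nabla q,\vec n\rangle=\langle V,\vec n\rangle$ on $\partial M$, with $\vec n$ the unit normal. With $\nabla$ the Levi-Civita connection of $M$, a Jacobi field along the geodesic $\eta$ with steady Eulerian velocity $X$ is $J(t)=Y(t)\circ\eta(t)$, where $Y(t),Z(t)\in T_{\mathrm{id}}\mathcal{D}_{\mu,E}(M)$ satisfy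 $$\frac{\partial Y}{\partial t}+[X,Y(t)]=Z(t),\qquad \frac{\partial Z}{\partial t}+P\big(\nabla_XZ(t)+\nabla_{Z(t)}X\big)=0.$$ The point $\eta(t_0)$, $t_0\neq0$, is monoconjugate to $\eta(0)$ along $\eta$ if there is a Jacobi field along $\eta$, not identically zero, that vanishes at $t=0$ and at $t=t_0$ (equivalently, the differential of the exponential map at $t_0X$ is not injective). *)

(* Defs.v *)
From Stdlib Require Import Reals Lra.
From Coquelicot Require Import Coquelicot.

Open Scope R_scope.

(** * Smoothness *)

Definition dirD {U : NormedModule R_AbsRing} (f : U -> R) (p v : U) : R :=
  Derive (fun s : R => f (plus p (scal s v))) 0.

Fixpoint Ck {U : NormedModule R_AbsRing} (k : nat) (f : U -> R) : Prop :=
  match k with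
  | O => forall p, continuous f p
  | S k' =>
      (forall p, continuous f p) /\
      (forall v : U,
         (forall p, ex_derive (fun s : R => f (plus p (scal s v))) 0) /\
         Ck k' (fun p => dirD f p v))
  end.

Definition smooth {U : NormedModule R_AbsRing} (f : U -> R) : Prop :=
  forall k : nat, Ck k f.

(** * The solid flat torus

    [D^2 x S^1] is the quotient of the solid cylinder [in_M] of R^3 by
    [z |-> z + 2 pi]; points are Cartesian coordinates [(x, y, z)], in which
    the metric is Euclidean and [r dr dtheta dz] is [dx dy dz].

    A smooth object on the manifold with boundary is given by a representative
    that is smooth on the whole of R^3 (every object smooth up to the boundary
    has one); all conditions are imposed on [in_M] only.  Since [in_M] is the
    closure of its interior, the derivatives of a representative at points of
    [in_M] depend only on its values on [in_M]. *)

Definition pt : Type := (R * R * R)%type.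
Definition px (p : pt) : R := fst (fst p).
Definition py (p : pt) : R := snd (fst p).
Definition pz (p : pt) : R := snd p.

Definition in_M (p : pt) : Prop := px p ^ 2 + py p ^ 2 <= 1.
Definition in_bdM (p : pt) : Prop := px p ^ 2 + py p ^ 2 = 1.
Definition radius (p : pt) : R := sqrt (px p ^ 2 + py p ^ 2).

Definition same_pt (p q : pt) : Prop :=
  px p = px q /\ py p = py q /\ exists k : Z, pz q = pz p + 2 * PI * IZR k.

Definition vzero : pt := (0, 0, 0).
Definition vadd (v w : pt) : pt := (px v + px w, py v + py w, pz v + pz w).
Definition vsub (v w : pt) : pt := (px v - px w, py v - py w, pz v - pz w).
Definition dot (v w : pt) : R := px v * px w + py v * py w + pz v * pz w.
Definition e_x : pt := (1, 0, 0).
Definition e_y : pt := (0, 1, 0).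
Definition e_z : pt := (0, 0, 1).
Definition normal (p : pt) : pt := (px p, py p, 0).

(** * Fields and differential operators *)

Definition smooth_map {U : NormedModule R_AbsRing} (F : U -> pt) : Prop :=
  smooth (fun a => px (F a)) /\ smooth (fun a => py (F a)) /\
  smooth (fun a => pz (F a)).

Definition dvec {U : NormedModule R_AbsRing} (F : U -> pt) (a v : U) : pt :=
  (dirD (fun b => px (F b)) a v, dirD (fun b => py (F b)) a v,
   dirD (fun b => pz (F b)) a v).

Definition smooth_curve (F : R -> pt -> pt) : Prop :=
  smooth_map (fun a : R * pt => F (fst a) (snd a)).

Definition dt (F : R -> pt -> pt) (t : R) (p : pt) : pt :=
  dvec (fun s : R => F s p) t 1.

Definition scalar_field (q : pt -> R) : Prop :=
  smooth q /\ forall p p', in_M p -> same_pt p p' -> q p' = q p.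

Definition vector_field (V : pt -> pt) : Prop :=
  smooth_map V /\ forall p p', in_M p -> same_pt p p' -> V p' = V p.

Definition grad (q : pt -> R) (p : pt) : pt :=
  (dirD q p e_x, dirD q p e_y, dirD q p e_z).

Definition divergence (V : pt -> pt) (p : pt) : R :=
  px (dvec V p e_x) + py (dvec V p e_y) + pz (dvec V p e_z).

Definition laplacian (q : pt -> R) (p : pt) : R := divergence (grad q) p.

(** [nabla V W] is [nabla_V W]: the Levi-Civita connection of the flat metric
    differentiates Cartesian components. *)
Definition nabla (V W : pt -> pt) (p : pt) : pt := dvec W p (V p).

Definition bracket (V W : pt -> pt) (p : pt) : pt :=
  vsub (nabla V W p) (nabla W V p).

(** [is_proj V W] says that [W = P(V)] on the manifold. *)
Definition is_proj (V W : pt -> pt) : Prop :=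
  exists q : pt -> R,
    scalar_field q /\
    (forall p, in_M p -> laplacian q p = divergence V p) /\
    (forall p, in_bdM p -> dot (grad q p) (normal p) = dot (V p) (normal p)) /\
    (forall p, in_M p -> W p = vsub (V p) (grad q p)).

(** * The group and its tangent space at the identity *)

(** [d/dtheta] in Cartesian coordinates, and its flow. *)
Definition E (p : pt) : pt := (- py p, px p, 0).
Definition rot (a : R) (p : pt) : pt :=
  (cos a * px p - sin a * py p, sin a * px p + cos a * py p, pz p).

(** [u(r) d/dtheta].  Only the values of [u] on [0, 1] matter; [u] is meant to be
    smooth on R (extended from [0, 1]), so that [u 0] is the limit of [u(r)] and
    the derivative of [u] at the endpoints is the one-sided one. *)
Definition swirl (u : R -> R) (p : pt) : pt :=
  (u (radius p) * px (E p), u (radius p) * py (E p), u (radius p) * pz (E p)).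

Definition tangent_id (Y : pt -> pt) : Prop :=
  vector_field Y /\
  (forall p, in_M p -> divergence Y p = 0) /\
  (forall p, in_bdM p -> dot (Y p) (normal p) = 0) /\
  (forall p, in_M p -> bracket E Y p = vzero).

(** A smooth self-map of [D^2 x S^1] is given by a lift to the cylinder. *)
Definition lifts_map (F : pt -> pt) : Prop :=
  smooth_map F /\
  (forall p, in_M p -> in_M (F p)) /\
  (forall p p', in_M p -> same_pt p p' -> same_pt (F p) (F p')).

Definition diffeo (F : pt -> pt) : Prop :=
  lifts_map F /\
  exists G : pt -> pt,
    lifts_map G /\
    (forall p, in_M p -> same_pt (F (G p)) p /\ same_pt (G (F p)) p).

Definition det3 (a b c : pt) : R :=
  px a * (py b * pz c - pz b * py c)
  - py a * (px b * pz c - pz b * px c)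
  + pz a * (px b * py c - py b * px c).

Definition in_DmuE (F : pt -> pt) : Prop :=
  diffeo F /\
  (forall p, in_M p -> det3 (dvec F p e_x) (dvec F p e_y) (dvec F p e_z) = 1) /\
  (forall a p, in_M p -> same_pt (F (rot a p)) (rot a (F p))).

(** * Geodesics, Jacobi fields and monoconjugate points *)

Definition euler_solution (v : R -> pt -> pt) : Prop :=
  smooth_curve v /\
  (forall t, tangent_id (v t)) /\
  (forall t, exists W : pt -> pt,
     is_proj (nabla (v t) (v t)) W /\
     forall p, in_M p -> vadd (dt v t p) (W p) = vzero).

(** Geodesics are the flows of solutions of the Euler equations. *)
Definition geodesic (eta : R -> pt -> pt) : Prop :=
  smooth_curve eta /\
  (forall t, in_DmuE (eta t)) /\
  exists v : R -> pt -> pt,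
    euler_solution v /\
    forall t p, in_M p -> dt eta t p = v t (eta t p).

(** Jacobi field along the geodesic [eta] whose Eulerian velocity is the steady
    field [X]; when [X] is a steady Euler solution, this is the geodesic issued
    from the identity with initial velocity [X].  The vector [J t p], based at [eta t p], is given by its
    Cartesian components. *)
Definition jacobi_field (X : pt -> pt) (eta J : R -> pt -> pt) : Prop :=
  exists Y Z : R -> pt -> pt,
    smooth_curve Y /\ smooth_curve Z /\
    (forall t, tangent_id (Y t)) /\ (forall t, tangent_id (Z t)) /\
    (forall t p, in_M p -> vadd (dt Y t p) (bracket X (Y t) p) = Z t p) /\
    (forall t, exists W : pt -> pt,
       is_proj (fun p => vadd (nabla X (Z t) p) (nabla (Z t) X p)) W /\
       forall p, in_M p -> vadd (dt Z t p) (W p) = vzero) /\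
    (forall t p, in_M p -> J t p = Y t (eta t p)).

Definition monoconjugate (X : pt -> pt) (eta : R -> pt -> pt) (t0 : R) : Prop :=
  t0 <> 0 /\
  exists J : R -> pt -> pt,
    jacobi_field X eta J /\
    (exists t p, in_M p /\ J t p <> vzero) /\
    (forall p, in_M p -> J 0 p = vzero) /\
    (forall p, in_M p -> J t0 p = vzero).

(** * The Sturm-Liouville problem *)

Definition omega (u : R -> R) (r : R) : R := 2 * u r + r * Derive u r.

(** The equation is imposed on [(0, 1)] together with left continuity at [1];
    since its coefficients are continuous up to [1], such a solution is
    automatically C^2 up to [1] and satisfies the equation there. *)
Definition sl_eigenvalue (u : R -> R) (n : nat) (lambda : R) : Prop :=
  exists psi : R -> R,
    (forall r, 0 < r < 1 ->
       ex_derive psi r /\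
       ex_derive (fun s => s * Derive psi s) r /\
       / r * Derive (fun s => s * Derive psi s) r
         - (INR n ^ 2 + / r ^ 2) * psi r
       = - 2 * lambda ^ 2 * u r * omega u r * psi r) /\
    psi 1 = 0 /\ filterlim psi (at_left 1) (locally (psi 1)) /\
    (exists l : R, filterlim psi (at_right 0) (locally l)) /\
    (exists r, 0 < r <= 1 /\ psi r <> 0).

(* Main.v *)
(** Linearising the Euler equation at [X = u(r) d/dtheta] on axisymmetric fields
    and taking [a(t) r psi(r) sin(n z)] as stream function, the unknowns separate:
    with [b] the amplitude of the swirl one gets [b' = a] and
    [a' = - (n / lambda)^2 b] precisely because [psi] solves the Sturm-Liouville
    equation.  So [a = cos(n t / lambda)], and the field [Y], obtained by integrating
    once more in time, starts at [0] and returns to [0] at [t = 2 pi lambda / n].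

    The regularity of [Y] is the delicate point.  Writing [psi = r chi], the equation
    becomes [chi'' + 3 chi' / r = Q chi], where
    [Q = n^2 - 2 lambda^2 u omega] extends to a smooth even function on R.
    Picard iteration at the singular point [0] gives a smooth even [chi] on R with
    [chi 0 = 1].  A Wronskian argument shows that the given [psi] is proportional to
    [r chi], whence [chi 1 = 0]; this excludes [lambda = 0], for which [Q >= 0] and
    [chi >= 1].  Finally a smooth even function [f] satisfies [f' = x k]
    with [k] smooth and even, so it gives a smooth function of the radius on R^3. *)

Require Import Defs.
From Stdlib Require Import Reals Lra.
From Coquelicot Require Import Coquelicot.
From Stdlib Require Import ZArith Lia FunctionalExtensionality.

Open Scope R_scope.

(** * Smooth functions on normed modules *)

(** Every division by a power of the radius is traded for the weighted mean [avg j g x], an integral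
    over the fixed interval [0, 1] that is as smooth as [g] and even when [g] is. This one device
    produces [chi] from its integral equation, the quotients chi'/r and u'/r, and the smoothness on
    R^3 of functions of the radius. The two swirls have different profiles: Z carries omega chi,
    while Y carries u chi. The reason is that the bracket [X, Y] is itself a swirl with profile r u'
    chi, and omega = 2u + r u' splits into this term and a multiple of u, which the time derivative
    of Y supplies. The projection P never requires solving a Neumann problem. The pressure is
    guessed as a multiple of (psi' + psi/r) cos(n z); subtracting its gradient from the linearised
    Euler term leaves a field already known to be divergence-free and tangent to the boundary, so
    the guess satisfies the conditions defining P. *)

Definition is_dirD {U : NormedModule R_AbsRing} (f : U -> R) (p v : U) (l : R) :=
  is_derive (fun s : R => f (plus p (scal s v))) 0 l.

Lemma line_0 {U : NormedModule R_AbsRing} (p v : U) : plus p (scal 0 v) = p.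
Proof.
  change (plus p (scal zero v) = p). rewrite scal_zero_l. apply plus_zero_r.
Qed.

Lemma dirD_unique {U : NormedModule R_AbsRing} (f : U -> R) (p v : U) (l : R) :
  is_dirD f p v l -> dirD f p v = l.
Proof. apply is_derive_unique. Qed.

Lemma is_dirD_const {U : NormedModule R_AbsRing} (c : R) (p v : U) :
  is_dirD (fun _ => c) p v 0.
Proof. apply (is_derive_const c 0). Qed.

Lemma is_dirD_plus {U : NormedModule R_AbsRing} (f g : U -> R) (p v : U) (a b : R) :
  is_dirD f p v a -> is_dirD g p v b -> is_dirD (fun q => f q + g q) p v (a + b).
Proof. intros Hf Hg. apply (is_derive_plus _ _ _ _ _ Hf Hg). Qed.

Lemma is_dirD_minus {U : NormedModule R_AbsRing} (f g : U -> R) (p v : U) (a b : R) :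
  is_dirD f p v a -> is_dirD g p v b -> is_dirD (fun q => f q - g q) p v (a - b).
Proof. intros Hf Hg. apply (is_derive_minus _ _ _ _ _ Hf Hg). Qed.

Lemma is_dirD_mult {U : NormedModule R_AbsRing} (f g : U -> R) (p v : U) (a b : R) :
  is_dirD f p v a -> is_dirD g p v b ->
  is_dirD (fun q => f q * g q) p v (a * g p + f p * b).
Proof.
  intros Hf Hg.
  pose proof (is_derive_mult _ _ 0 a b Hf Hg Rmult_comm) as H.
  simpl in H. rewrite (line_0 p v) in H. exact H.
Qed.

Lemma is_dirD_comp {U : NormedModule R_AbsRing} (h : R -> R) (f : U -> R) (p v : U) (a b : R) :
  is_derive h (f p) b -> is_dirD f p v a -> is_dirD (fun q => h (f q)) p v (a * b).
Proof.
  intros Hh Hf. unfold is_dirD.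
  apply (is_derive_comp h (fun s : R => f (plus p (scal s v))) 0 b a); [|exact Hf].
  now rewrite (line_0 p v).
Qed.

Lemma is_dirD_linear {U : NormedModule R_AbsRing} (l : U -> R) (p v : U) :
  is_linear l -> is_dirD l p v (l v).
Proof.
  intros Hl. unfold is_dirD.
  apply is_derive_ext with (fun s : R => l p + s * l v).
  - intros s. rewrite (linear_plus l Hl). now rewrite (linear_scal l Hl).
  - auto_derive; [easy | ring].
Qed.

Lemma is_dirD_comp_linear {U V : NormedModule R_AbsRing} (l : U -> V) (f : V -> R) (p v : U) (a : R) :
  is_linear l -> is_dirD f (l p) (l v) a -> is_dirD (fun q => f (l q)) p v a.
Proof.
  intros Hl. apply is_derive_ext. intros s.
  now rewrite (linear_plus l Hl), (linear_scal l Hl).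
Qed.

Lemma is_dirD_ext {U : NormedModule R_AbsRing} (f g : U -> R) (p v : U) (a : R) :
  (forall q, f q = g q) -> is_dirD f p v a -> is_dirD g p v a.
Proof. intros H. apply is_derive_ext. intros s; apply H. Qed.

Lemma Ck_ext {U : NormedModule R_AbsRing} (k : nat) (f g : U -> R) :
  (forall p, f p = g p) -> Ck k f -> Ck k g.
Proof. intros H. now replace g with f by (apply functional_extensionality, H). Qed.

(** [dirD] is a total operator, so its value must be identified before regularity of the derivative
    can be stated. Supplying a closed form [f' v p] does both at once, and every later proof of
    smoothness by induction goes through this rule. *)
Lemma Ck_S_intro {U : NormedModule R_AbsRing} (k : nat) (f : U -> R) (f' : U -> U -> R) :
  (forall p, continuous f p) -> (forall p v, is_dirD f p v (f' v p)) ->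
  (forall v, Ck k (f' v)) -> Ck (S k) f.
Proof.
  intros Hc Hd Hk. split; [exact Hc|]. intros v. split.
  - intros p. exists (f' v p). apply Hd.
  - apply Ck_ext with (f' v); [|apply Hk].
    intros p. symmetry. apply dirD_unique, Hd.
Qed.

Lemma Ck_continuous {U : NormedModule R_AbsRing} (k : nat) (f : U -> R) (p : U) :
  Ck k f -> continuous f p.
Proof. destruct k; [intros H; apply H | intros [H _]; apply H]. Qed.

Lemma Ck_S_dirD {U : NormedModule R_AbsRing} (k : nat) (f : U -> R) (p v : U) :
  Ck (S k) f -> is_dirD f p v (dirD f p v).
Proof. intros [_ H]. apply Derive_correct, H. Qed.

Lemma Ck_pred {U : NormedModule R_AbsRing} (k : nat) (f : U -> R) : Ck (S k) f -> Ck k f.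
Proof.
  revert f. induction k as [|k IH]; intros f [Hc H]; [exact Hc|].
  split; [exact Hc|]. intros v. destruct (H v) as [He Hk].
  split; [exact He | apply IH, Hk].
Qed.

Lemma Ck_const {U : NormedModule R_AbsRing} (k : nat) (c : R) : Ck k (fun _ : U => c).
Proof.
  revert c. induction k as [|k IH]; intros c.
  - intros p. apply continuous_const.
  - apply Ck_S_intro with (fun _ _ => 0); [|intros; apply is_dirD_const | intros; apply IH].
    intros p. apply continuous_const.
Qed.

Lemma Ck_plus {U : NormedModule R_AbsRing} (k : nat) (f g : U -> R) :
  Ck k f -> Ck k g -> Ck k (fun p => f p + g p).
Proof.
  revert f g. induction k as [|k IH]; intros f g Hf Hg.
  - intros p. apply (continuous_plus (V := R_NormedModule) f g); [apply Hf | apply Hg].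
  - apply Ck_S_intro with (fun v p => dirD f p v + dirD g p v).
    + intros p. apply (continuous_plus (V := R_NormedModule) f g);
        apply (Ck_continuous (S k)); assumption.
    + intros p v. apply is_dirD_plus; apply (Ck_S_dirD k); assumption.
    + intros v. apply IH; [apply Hf | apply Hg].
Qed.

Lemma Ck_mult {U : NormedModule R_AbsRing} (k : nat) (f g : U -> R) :
  Ck k f -> Ck k g -> Ck k (fun p => f p * g p).
Proof.
  revert f g. induction k as [|k IH]; intros f g Hf Hg.
  - intros p. apply (continuous_mult (K := R_AbsRing) f g); [apply Hf | apply Hg].
  - apply Ck_S_intro with (fun v p => dirD f p v * g p + f p * dirD g p v).
    + intros p. apply (continuous_mult (K := R_AbsRing) f g);
        apply (Ck_continuous (S k)); assumption.
    + intros p v. apply is_dirD_mult; apply (Ck_S_dirD k); assumption.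
    + intros v. apply Ck_plus; apply IH; try (apply Ck_pred; assumption);
        [apply Hf | apply Hg].
Qed.

Lemma Ck_linear {U : NormedModule R_AbsRing} (k : nat) (l : U -> R) :
  is_linear l -> Ck k l.
Proof.
  intros Hl. destruct k.
  - intros p. now apply (linear_cont l p).
  - apply Ck_S_intro with (fun v p => l v).
    + intros p. now apply (linear_cont l p).
    + intros p v. now apply is_dirD_linear.
    + intros v. apply Ck_const.
Qed.

Lemma Ck_comp_linear {U V : NormedModule R_AbsRing} (k : nat) (l : U -> V) (f : V -> R) :
  is_linear l -> Ck k f -> Ck k (fun p => f (l p)).
Proof.
  intros Hl. revert f. induction k as [|k IH]; intros f Hf.
  - intros p. apply (continuous_comp l f); [now apply linear_cont | apply Hf].
  - apply Ck_S_intro with (fun v p => dirD f (l p) (l v)).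
    + intros p. apply (continuous_comp l f);
        [now apply linear_cont | now apply (Ck_continuous (S k))].
    + intros p v. apply (is_dirD_comp_linear l); [exact Hl | now apply (Ck_S_dirD k)].
    + intros v. apply (IH (fun q => dirD f q (l v))). apply Hf.
Qed.

Lemma is_dirD_R (f : R -> R) (x v l : R) : is_derive f x l -> is_dirD f x v (v * l).
Proof.
  intros H. unfold is_dirD.
  apply (is_derive_comp f (fun s : R => plus x (scal s v)) 0 l v).
  - apply (eq_ind_r (fun y => is_derive f y l) H (line_0 (U := R_NormedModule) x v)).
  - unfold plus, scal, mult; simpl; unfold mult; simpl. auto_derive; [easy | ring].
Qed.

Lemma dirD_R_1 (f : R -> R) (x l : R) : is_derive f x l <-> is_dirD f x 1 l.
Proof.
  split.
  - intros H. rewrite <- (Rmult_1_l l). now apply is_dirD_R.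
  - intros H. unfold is_dirD in H.
    apply is_derive_ext with (fun y => f (plus x (scal (y - x) 1))).
    + intros y. f_equal. unfold plus, scal, mult; simpl; unfold mult; simpl. ring.
    + rewrite <- (Rmult_1_l l).
      apply (is_derive_comp (fun s => f (plus x (scal s 1))) (fun y => y - x) x l 1).
      * now rewrite Rminus_diag.
      * auto_derive; [easy | ring].
Qed.

Lemma Ck_R_S_intro (k : nat) (f f' : R -> R) :
  (forall x, is_derive f x (f' x)) -> Ck k f' -> Ck (S k) f.
Proof.
  intros Hd Hk. apply Ck_S_intro with (fun v x => v * f' x).
  - intros x. apply (ex_derive_continuous f x). exists (f' x). apply Hd.
  - intros x v. apply is_dirD_R, Hd.
  - intros v. apply Ck_mult; [apply Ck_const | exact Hk].
Qed.

Lemma Ck_R_S_elim (k : nat) (f : R -> R) :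
  Ck (S k) f -> (forall x, is_derive f x (Derive f x)) /\ Ck k (Derive f).
Proof.
  intros H.
  assert (D : forall x, is_derive f x (dirD f x 1)).
  { intros x. apply dirD_R_1. now apply (Ck_S_dirD k). }
  split.
  - intros x. apply Derive_correct. eexists. apply D.
  - apply Ck_ext with (fun x => dirD f x 1); [|apply H].
    intros x. symmetry. apply is_derive_unique, D.
Qed.

Lemma Ck_comp {U : NormedModule R_AbsRing} (k : nat) (h : R -> R) (f : U -> R) :
  Ck k h -> Ck k f -> Ck k (fun p => h (f p)).
Proof.
  revert h f. induction k as [|k IH]; intros h f Hh Hf.
  - intros p. apply (continuous_comp f h); [apply Hf | apply Hh].
  - destruct (Ck_R_S_elim k h Hh) as [Hd Hk].
    apply Ck_S_intro with (fun v p => dirD f p v * Derive h (f p)).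
    + intros p. apply (continuous_comp f h);
        [exact (Ck_continuous (S k) f p Hf) | exact (Ck_continuous (S k) h (f p) Hh)].
    + intros p v. apply is_dirD_comp; [apply Hd | now apply (Ck_S_dirD k)].
    + intros v. apply Ck_mult; [apply Hf|]. apply IH; [exact Hk | now apply Ck_pred].
Qed.

Lemma smooth_const {U : NormedModule R_AbsRing} (c : R) : smooth (fun _ : U => c).
Proof. intros k; apply Ck_const. Qed.

Lemma smooth_plus {U : NormedModule R_AbsRing} (f g : U -> R) :
  smooth f -> smooth g -> smooth (fun p => f p + g p).
Proof. intros Hf Hg k; now apply Ck_plus. Qed.

Lemma smooth_mult {U : NormedModule R_AbsRing} (f g : U -> R) :
  smooth f -> smooth g -> smooth (fun p => f p * g p).
Proof. intros Hf Hg k; now apply Ck_mult. Qed.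

Lemma smooth_opp {U : NormedModule R_AbsRing} (f : U -> R) :
  smooth f -> smooth (fun p => - f p).
Proof.
  intros Hf k. apply Ck_ext with (fun p => -1 * f p); [intros; ring|].
  apply smooth_mult; [apply smooth_const | exact Hf].
Qed.

Lemma smooth_minus {U : NormedModule R_AbsRing} (f g : U -> R) :
  smooth f -> smooth g -> smooth (fun p => f p - g p).
Proof. intros Hf Hg. apply smooth_plus; [exact Hf | now apply smooth_opp]. Qed.

Lemma smooth_linear {U : NormedModule R_AbsRing} (l : U -> R) : is_linear l -> smooth l.
Proof. intros H k; now apply Ck_linear. Qed.

Lemma smooth_comp_linear {U V : NormedModule R_AbsRing} (l : U -> V) (f : V -> R) :
  is_linear l -> smooth f -> smooth (fun p => f (l p)).
Proof. intros H Hf k; now apply Ck_comp_linear. Qed.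

Lemma smooth_comp {U : NormedModule R_AbsRing} (h : R -> R) (f : U -> R) :
  smooth h -> smooth f -> smooth (fun p => h (f p)).
Proof. intros Hh Hf k; now apply Ck_comp. Qed.

Lemma smooth_R_derive (f : R -> R) (x : R) : smooth f -> is_derive f x (Derive f x).
Proof. intros H. now apply (Ck_R_S_elim 0 f (H 1%nat)). Qed.

Lemma smooth_Derive (f : R -> R) : smooth f -> smooth (Derive f).
Proof. intros H k. now apply (Ck_R_S_elim k f (H (S k))). Qed.

Lemma smooth_R_continuous (f : R -> R) (x : R) : smooth f -> continuous f x.
Proof. intros H. apply (H 0%nat). Qed.

Lemma smooth_R_intro (f f' : R -> R) :
  (forall x, is_derive f x (f' x)) -> smooth f' -> smooth f.
Proof.
  intros Hd H [|k].
  - intros x. apply (ex_derive_continuous f x). exists (f' x). apply Hd.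
  - now apply (Ck_R_S_intro k f f').
Qed.

Lemma smooth_id : smooth (fun x : R => x).
Proof. apply smooth_linear, (is_linear_id (V := R_NormedModule)). Qed.

Lemma smooth_cos_sin : smooth cos /\ smooth sin.
Proof.
  assert (H : forall k, Ck k cos /\ Ck k sin).
  { induction k as [|k [Hc Hs]].
    - split; intros x; [apply (ex_derive_continuous cos x) | apply (ex_derive_continuous sin x)];
        auto_derive; easy.
    - split.
      + apply Ck_R_S_intro with (fun x => -1 * sin x).
        * intros x. auto_derive; [easy | ring].
        * apply Ck_mult; [apply Ck_const | exact Hs].
      + apply Ck_R_S_intro with cos; [|exact Hc].
        intros x. auto_derive; [easy | ring]. }
  split; intros k; apply H.
Qed.

(** * Weighted averages and smooth even functions *)

(** For nonzero [x], the substitution s = x r shows that this is x^-(j+1) times the integral of s^j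
    g(s) from 0 to x. The form over [0, 1] also makes sense at [x = 0] and has no singularity
    there. *)
Definition avg (j : nat) (g : R -> R) (x : R) : R := RInt (fun r => r ^ j * g (x * r)) 0 1.

Lemma continuous_avg_integrand (j : nat) (g : R -> R) (x r : R) :
  (forall y, continuous g y) -> continuous (fun r => r ^ j * g (x * r)) r.
Proof.
  intros Hg.
  apply (continuous_mult (K := R_AbsRing) (fun r => r ^ j) (fun r => g (x * r))).
  - apply (ex_derive_continuous (fun r => r ^ j)). auto_derive; easy.
  - apply (continuous_comp (fun r => x * r) g); [|apply Hg].
    apply (ex_derive_continuous (fun r => x * r)). auto_derive; easy.
Qed.

Lemma ex_RInt_avg (j : nat) (g : R -> R) (x : R) :
  (forall y, continuous g y) -> ex_RInt (fun r => r ^ j * g (x * r)) 0 1.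
Proof.
  intros Hg. apply (ex_RInt_continuous (V := R_CompleteNormedModule)).
  intros r _. now apply continuous_avg_integrand.
Qed.

Lemma avg_bound (j : nat) (g : R -> R) (x M : R) :
  (forall y, continuous g y) -> (forall r, 0 <= r <= 1 -> Rabs (g (x * r)) <= M) ->
  Rabs (avg j g x) <= M.
Proof.
  intros Hg HM. unfold avg.
  replace M with ((1 - 0) * M) by ring.
  apply (abs_RInt_le_const (fun r => r ^ j * g (x * r))); [lra | now apply ex_RInt_avg |].
  intros r Hr. rewrite Rabs_mult.
  rewrite <- (Rmult_1_l M). apply Rmult_le_compat; try apply Rabs_pos; [|now apply HM].
  rewrite Rabs_pos_eq by (apply pow_le; lra).
  rewrite <- (pow1 j). apply pow_incr. lra.
Qed.

Lemma avg_continuous (j : nat) (g : R -> R) (x : R) :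
  (forall y, continuous g y) -> continuous (avg j g) x.
Proof.
  intros Hg. apply continuity_pt_filterlim.
  intros eps Heps.
  (* All points y r with |y - x| < 1 and 0 <= r <= 1 lie in [-b, b], where [g] is uniformly
     continuous. *)
  set (b := Rabs x + 1).
  assert (Hb : 0 <= b) by (unfold b; generalize (Rabs_pos x); lra).
  assert (He2 : 0 < eps / 2) by lra.
  destruct (Heine_cor2 (f := g) (a := - b) (b := b)
    (fun y _ => proj2 (continuity_pt_filterlim g y) (Hg y)) (mkposreal _ He2)) as [delta Hd].
  simpl in Hd.
  exists (Rmin delta 1). split.
  { apply Rmin_pos; [apply delta | lra]. }
  intros y [_ Hy]. simpl in Hy |- *. unfold R_dist, Rdist in *.
  assert (Hy1 : Rabs (y - x) < delta) by (eapply Rlt_le_trans; [exact Hy | apply Rmin_l]).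
  assert (Hy2 : Rabs (y - x) < 1) by (eapply Rlt_le_trans; [exact Hy | apply Rmin_r]).
  apply Rle_lt_trans with (eps / 2); [|lra].
  unfold avg.
  pose proof (RInt_minus (V := R_CompleteNormedModule) _ _ 0 1 (ex_RInt_avg j g y Hg) (ex_RInt_avg j g x Hg)) as H.
  unfold minus, plus, opp in H; simpl in H. unfold Rminus at 1. rewrite <- H.
  replace (eps / 2) with ((1 - 0) * (eps / 2)) by ring.
  apply (abs_RInt_le_const (fun r => r ^ j * g (y * r) + - (r ^ j * g (x * r)))); [lra | |].
  - exact (ex_RInt_minus (V := R_CompleteNormedModule) _ _ 0 1 (ex_RInt_avg j g y Hg) (ex_RInt_avg j g x Hg)).
  - intros r Hr.
    assert (Hin : forall z, Rabs z <= b -> - b <= z * r <= b).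
    { intros z Hz. apply Rabs_le_between. rewrite Rabs_mult, (Rabs_pos_eq r) by lra.
      rewrite <- (Rmult_1_r b). apply Rmult_le_compat; try lra; apply Rabs_pos. }
    replace (r ^ j * g (y * r) + - (r ^ j * g (x * r)))
      with (r ^ j * (g (y * r) - g (x * r))) by ring.
    rewrite Rabs_mult, <- (Rmult_1_l (eps / 2)).
    apply Rmult_le_compat; try apply Rabs_pos.
    + rewrite Rabs_pos_eq by (apply pow_le; lra).
      rewrite <- (pow1 j). apply pow_incr. lra.
    + left. apply Hd.
      * apply Hin. unfold b. replace y with ((y - x) + x) by ring.
        eapply Rle_trans; [apply Rabs_triang | lra].
      * apply Hin. unfold b. lra.
      * rewrite <- Rmult_minus_distr_r, Rabs_mult.
        apply Rle_lt_trans with (Rabs (y - x) * 1); [|lra].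
        apply Rmult_le_compat_l; [apply Rabs_pos|]. rewrite Rabs_pos_eq; lra.
Qed.

(** Differentiating under the integral brings down a factor r, which only raises the weight. The
    family of means is thus closed under differentiation, and [Ck_avg] follows by induction with the
    weight left free. *)
Lemma is_derive_avg (j : nat) (g g' : R -> R) (x : R) :
  (forall y, is_derive g y (g' y)) -> (forall y, continuous g' y) ->
  is_derive (avg j g) x (avg (S j) g' x).
Proof.
  intros Hd Hc.
  assert (Hgc : forall y, continuous g y).
  { intros y. apply (ex_derive_continuous g y). now exists (g' y). }
  assert (D : forall z r, is_derive (fun z => r ^ j * g (z * r)) z (r ^ S j * g' (z * r))).
  { intros z r. auto_derive.
    - exists (g' (z * r)). apply Hd.
    - rewrite (is_derive_unique (fun y : R => g y) _ _ (Hd (z * r))). simpl. ring. }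
  unfold avg.
  replace (RInt (fun r => r ^ S j * g' (x * r)) 0 1)
    with (RInt (fun r => Derive (fun z => r ^ j * g (z * r)) x) 0 1).
  2: { apply RInt_ext. intros r _. apply is_derive_unique, D. }
  apply (is_derive_RInt_param (fun z r => r ^ j * g (z * r))).
  - exists (mkposreal 1 Rlt_0_1). intros y _ t _. eexists. apply D.
  - intros t _. apply continuity_2d_pt_ext with (fun u v => v ^ S j * g' (u * v)).
    + intros u v. symmetry. apply is_derive_unique, D.
    + apply (continuity_2d_pt_mult (fun _ v => v ^ S j) (fun u v => g' (u * v))).
      * apply (continuity_1d_2d_pt_comp (fun v => v ^ S j) (fun _ v => v)).
        -- apply continuity_pt_filterlim, (ex_derive_continuous (fun v => v ^ S j)).
           auto_derive; easy.
        -- apply continuity_2d_pt_id2.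
      * apply (continuity_1d_2d_pt_comp g' (fun u v => u * v)).
        -- apply continuity_pt_filterlim, Hc.
        -- apply continuity_2d_pt_mult; [apply continuity_2d_pt_id1 | apply continuity_2d_pt_id2].
  - exists (mkposreal 1 Rlt_0_1). intros y _. now apply ex_RInt_avg.
Qed.

Lemma Ck_avg (k j : nat) (g : R -> R) : Ck k g -> Ck k (avg j g).
Proof.
  revert j g. induction k as [|k IH]; intros j g Hg.
  - intros x. apply avg_continuous, Hg.
  - destruct (Ck_R_S_elim k g Hg) as [Hd Hk].
    apply Ck_R_S_intro with (avg (S j) (Derive g)); [|now apply IH].
    intros x. apply is_derive_avg; [exact Hd|]. intros y. exact (Ck_continuous k _ y Hk).
Qed.

Lemma smooth_avg (j : nat) (g : R -> R) : smooth g -> smooth (avg j g).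
Proof. intros H k. apply Ck_avg, H. Qed.

(* Integrate [(r^(j+1) g (x r))'] over [0, 1]. *)
Lemma avg_by_parts (j : nat) (g g' : R -> R) (x : R) :
  (forall y, is_derive g y (g' y)) -> (forall y, continuous g' y) ->
  INR (S j) * avg j g x + x * avg (S j) g' x = g x.
Proof.
  intros Hd Hc.
  assert (Hgc : forall y, continuous g y).
  { intros y. apply (ex_derive_continuous g y). now exists (g' y). }
  unfold avg.
  assert (I1 : is_RInt (fun r => INR (S j) * (r ^ j * g (x * r)) + x * (r ^ S j * g' (x * r))) 0 1
     (INR (S j) * RInt (fun r => r ^ j * g (x * r)) 0 1 + x * RInt (fun r => r ^ S j * g' (x * r)) 0 1)).
  { apply (is_RInt_plus (V := R_NormedModule)); apply (is_RInt_scal (V := R_NormedModule));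
    apply (RInt_correct (V := R_CompleteNormedModule)); now apply ex_RInt_avg. }
  assert (I2 : is_RInt (fun r => INR (S j) * (r ^ j * g (x * r)) + x * (r ^ S j * g' (x * r))) 0 1 (g x)).
  { replace (g x) with (1 ^ S j * g (x * 1) - 0 ^ S j * g (x * 0))
      by (rewrite pow1, Rmult_1_r; simpl; ring).
    apply (is_RInt_derive (fun r => r ^ S j * g (x * r))).
    - intros r _. auto_derive.
      + exists (g' (x * r)). apply Hd.
      + rewrite (is_derive_unique (fun y : R => g y) _ _ (Hd (x * r))). change (match j with 0%nat => 1 | S _ => INR j + 1 end) with (INR (S j)).
        simpl pow. ring.
    - intros r _.
      apply (continuous_plus (V := R_NormedModule)).
      + apply (continuous_scal_r (V := R_NormedModule)). now apply continuous_avg_integrand.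
      + apply (continuous_scal_r (V := R_NormedModule)). now apply (continuous_avg_integrand (S j)). }
  rewrite <- (is_RInt_unique _ _ _ _ I1). exact (is_RInt_unique _ _ _ _ I2).
Qed.

Lemma avg_even (j : nat) (g : R -> R) (x : R) :
  (forall y, g (- y) = g y) -> avg j g (- x) = avg j g x.
Proof.
  intros H. apply RInt_ext. intros r _.
  replace (- x * r) with (- (x * r)) by ring. now rewrite H.
Qed.

Lemma avg_nonneg (j : nat) (g : R -> R) (x : R) :
  (forall y, continuous g y) -> (forall y, 0 <= g y) -> 0 <= avg j g x.
Proof.
  intros Hc Hg. apply RInt_ge_0; [lra | now apply ex_RInt_avg |].
  intros r Hr. apply Rmult_le_pos; [apply pow_le; lra | apply Hg].
Qed.

Lemma derive_even (f : R -> R) (x : R) :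
  smooth f -> (forall y, f (- y) = f y) -> Derive f (- x) = - Derive f x.
Proof.
  intros Hs He.
  assert (H : is_derive f x (- Derive f (- x))).
  { apply is_derive_ext with (fun y => f (- y)); [exact He|].
    auto_derive; [eexists; now apply smooth_R_derive|].
    change (Derive (fun y : R => f y)) with (Derive f). ring. }
  apply is_derive_unique in H. lra.
Qed.

Definition even_smooth (f : R -> R) : Prop := smooth f /\ forall x, f (- x) = f x.

(** Integrate the derivative of f(x r) in r over [0, 1]. The gain is that the difference quotient at
    0 is a mean, hence smooth. *)
Lemma hadamard (f : R -> R) (x : R) : smooth f -> f x - f 0 = x * avg 0 (Derive f) x.
Proof.
  intros Hs. assert (Hs1 := smooth_Derive f Hs).
  assert (I : is_RInt (fun r => x * (r ^ 0 * Derive f (x * r))) 0 1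
                (minus (f (x * 1)) (f (x * 0)))).
  { apply (is_RInt_derive (fun r => f (x * r))).
    - intros r _. auto_derive; [eexists; now apply smooth_R_derive|]. simpl. ring_simplify. reflexivity.
    - intros r _. apply (continuous_scal_r (V := R_NormedModule)).
      apply continuous_avg_integrand. intros y. now apply smooth_R_continuous. }
  assert (I' := is_RInt_scal (V := R_NormedModule) _ _ _ x _
     (RInt_correct (V := R_CompleteNormedModule) _ _ _
        (ex_RInt_avg 0 (Derive f) x (fun y => smooth_R_continuous _ y Hs1)))).
  assert (E := eq_trans (eq_sym (is_RInt_unique (V := R_CompleteNormedModule) _ _ _ _ I'))
                        (is_RInt_unique (V := R_CompleteNormedModule) _ _ _ _ I)).
  change (x * avg 0 (Derive f) x = f (x * 1) - f (x * 0)) in E.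
  rewrite Rmult_0_r, Rmult_1_r in E. now symmetry.
Qed.

(* Hadamard's lemma applied to the odd function [f']. *)
Definition reduced_derive (f : R -> R) : R -> R := avg 0 (Derive (Derive f)).

Lemma reduced_derive_spec (f : R -> R) (x : R) :
  even_smooth f -> is_derive f x (x * reduced_derive f x).
Proof.
  intros [Hs He].
  assert (H0 : Derive f 0 = 0).
  { generalize (derive_even f 0 Hs He). rewrite Ropp_0. lra. }
  unfold reduced_derive. rewrite <- hadamard by now apply smooth_Derive.
  rewrite H0, Rminus_0_r. now apply smooth_R_derive.
Qed.

Lemma even_smooth_reduced_derive (f : R -> R) :
  even_smooth f -> even_smooth (reduced_derive f).
Proof.
  intros [Hs He].
  assert (Hs1 := smooth_Derive f Hs). assert (Hs2 := smooth_Derive _ Hs1).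
  split; [exact (smooth_avg 0 _ Hs2)|].
  intros x. apply (avg_even 0 (Derive (Derive f))). intros y.
  assert (H : is_derive (Derive f) y (Derive (Derive f) (- y))).
  { apply is_derive_ext with (fun z => - Derive f (- z)).
    - intros z. rewrite derive_even by assumption. apply Ropp_involutive.
    - auto_derive; [eexists; now apply smooth_R_derive|].
      change (Derive (fun x0 : R => Derive f x0)) with (Derive (Derive f)). ring. }
  apply is_derive_unique in H. now symmetry.
Qed.

(** * The regular solution at the singular point *)

Lemma avg_ext (j : nat) (f g : R -> R) (x : R) :
  (forall y, f y = g y) -> avg j f x = avg j g x.
Proof. intros H. apply RInt_ext. intros r _. now rewrite H. Qed.

Lemma avg_plus (j : nat) (f g : R -> R) (x : R) :
  (forall y, continuous f y) -> (forall y, continuous g y) ->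
  avg j (fun y => f y + g y) x = avg j f x + avg j g x.
Proof.
  intros Hf Hg. unfold avg.
  etransitivity; [|exact (RInt_plus (V := R_CompleteNormedModule) _ _ 0 1
                            (ex_RInt_avg j f x Hf) (ex_RInt_avg j g x Hg))].
  apply RInt_ext. intros r _. apply Rmult_plus_distr_l.
Qed.

(** Refines [avg_bound] by exploiting decay of [g] towards 0: the denominator j + m + 1 is the
    integral of r^(j+m), and these denominators build up the factorial in the Picard estimate. *)
Lemma avg_bound_pow (j m : nat) (g : R -> R) (x K : R) :
  (forall y, continuous g y) ->
  (forall r, 0 <= r <= 1 -> Rabs (g (x * r)) <= K * r ^ m) ->
  Rabs (avg j g x) <= K / INR (S (j + m)).
Proof.
  intros Hg HK.
  assert (HI : is_RInt (fun r => r ^ j * (K * r ^ m)) 0 1 (K / INR (S (j + m)))).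
  { assert (HS : INR (S (j + m)) <> 0) by (apply not_0_INR; lia).
    replace (K / INR (S (j + m)))
      with (K / INR (S (j + m)) * 1 ^ S (j + m) - K / INR (S (j + m)) * 0 ^ S (j + m))
      by (rewrite pow1; simpl; ring).
    apply (is_RInt_derive (fun r => K / INR (S (j + m)) * r ^ S (j + m))).
    - intros r _. auto_derive; [easy|].
      change (match (j + m)%nat with 0%nat => 1 | S _ => INR (j + m) + 1 end)
        with (INR (S (j + m))).
      rewrite pow_add. field. exact HS.
    - intros r _. apply (ex_derive_continuous (fun r => r ^ j * (K * r ^ m))).
      auto_derive; easy. }
  unfold avg.
  apply (norm_RInt_le (V := R_NormedModule) (fun r => r ^ j * g (x * r))
           (fun r => r ^ j * (K * r ^ m)) 0 1 _ _ Rle_0_1).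
  - intros r Hr. change (Rabs (r ^ j * g (x * r)) <= r ^ j * (K * r ^ m)).
    assert (0 <= r ^ j) by (apply pow_le; lra).
    rewrite Rabs_mult, (Rabs_pos_eq (r ^ j)) by assumption.
    apply Rmult_le_compat_l; [assumption | now apply HK].
  - apply (RInt_correct (V := R_CompleteNormedModule)). now apply ex_RInt_avg.
  - exact HI.
Qed.

Lemma avg_primitive (h : R -> R) (x : R) :
  (forall y, continuous h y) -> x ^ 2 * avg 1 h x = RInt (fun s => s * h s) 0 x.
Proof.
  intros Hh.
  assert (Hc : forall y, continuous (fun s => s * h s) y).
  { intros y. apply (continuous_mult (K := R_AbsRing) (fun s => s) h);
      [apply continuous_id | apply Hh]. }
  pose proof (RInt_comp_lin (V := R_CompleteNormedModule) (fun s => s * h s) x 0 0 1) as H.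
  replace (x * 0 + 0) with 0 in H by ring. replace (x * 1 + 0) with x in H by ring.
  etransitivity; [|apply H].
  2: { apply (ex_RInt_continuous (V := R_CompleteNormedModule)). intros; apply Hc. }
  symmetry.
  etransitivity; [|exact (RInt_scal (V := R_CompleteNormedModule) _ 0 1 (x ^ 2) (ex_RInt_avg 1 h x Hh))].
  apply RInt_ext. intros r _. change (x * ((x * r + 0) * h (x * r + 0)) = x ^ 2 * (r ^ 1 * h (x * r))).
  rewrite Rplus_0_r. ring.
Qed.

(** Only continuity of [h] is assumed, whereas [is_derive_avg] needs a derivative of the integrand.
    This gain of one derivative starts the regularity bootstrap for the solution of the integral
    equation. *)
Lemma is_derive_avg_primitive (h : R -> R) (x : R) :
  (forall y, continuous h y) -> is_derive (fun y => y ^ 2 * avg 1 h y) x (x * h x).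
Proof.
  intros Hh.
  assert (Hc : forall y, continuous (fun s => s * h s) y).
  { intros y. apply (continuous_mult (K := R_AbsRing) (fun s => s) h);
      [apply continuous_id | apply Hh]. }
  apply is_derive_ext with (RInt (fun s => s * h s) 0).
  - intros y. symmetry. now apply avg_primitive.
  - apply (is_derive_RInt (fun s => s * h s) (RInt (fun s => s * h s) 0) 0 x); [|apply Hc].
    exists (mkposreal 1 Rlt_0_1). intros y _.
    apply (RInt_correct (V := R_CompleteNormedModule)), (ex_RInt_continuous (V := R_CompleteNormedModule)). intros; apply Hc.
Qed.

(** The M-test: on the ball the remainder is dominated by the tail of the numerical series [b],
    independently of [y]. *)
Lemma weierstrass_CVU (a : nat -> R -> R) (b : nat -> R) (r : posreal) :
  (forall k y, Boule 0 r y -> Rabs (a k y) <= b k) -> ex_series b ->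
  CVU (fun n y => sum_f_R0 (fun k => a k y) n) (fun y => Series (fun k => a k y)) 0 r.
Proof.
  intros Hab Hb eps Heps.
  assert (Hl : is_lim_seq (sum_n b) (Series b)) by exact (Series_correct _ Hb).
  apply is_lim_seq_spec in Hl.
  destruct (Hl (mkposreal eps Heps)) as [N HN].
  exists N. intros n y Hn Hy.
  assert (Ha : ex_series (fun k => Rabs (a k y))).
  { apply (ex_series_le (K := R_AbsRing) (V := R_CompleteNormedModule) _ b); [|exact Hb].
    intros k. change (Rabs (Rabs (a k y)) <= b k). rewrite Rabs_Rabsolu. now apply Hab. }
  (* [sum_f_R0 _ n] has n + 1 terms, so the series is split at [S n]. *)
  rewrite (Series_incr_n (fun k => a k y) (S n)) by (try lia; now apply ex_series_Rabs).
  simpl pred.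
  specialize (HN n Hn). simpl in HN.
  assert (E : Series b = sum_f_R0 b n + Series (fun k => b (S n + k)%nat))
    by (apply (Series_incr_n b (S n)); [lia | exact Hb]).
  rewrite sum_n_Reals, E in HN.
  replace (sum_f_R0 (fun k => a k y) n + Series (fun k => a (S n + k)%nat y) - sum_f_R0 (fun k => a k y) n)
    with (Series (fun k => a (S n + k)%nat y)) by ring.
  assert (Hb' : ex_series (fun k => b (S n + k)%nat)) by (now apply ex_series_incr_n).
  assert (Ha' : ex_series (fun k => Rabs (a (S n + k)%nat y)))
    by (now apply (ex_series_incr_n (fun k => Rabs (a k y)) (S n))).
  eapply Rle_lt_trans; [apply Series_Rabs; exact Ha'|].
  eapply Rle_lt_trans.
  { apply Series_le with (b := fun k => b (S n + k)%nat); [|exact Hb'].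
    intros k. split; [apply Rabs_pos | now apply Hab]. }
  eapply Rle_lt_trans; [|exact HN].
  rewrite <- Rabs_Ropp. eapply Rle_trans; [apply Rle_abs | right; f_equal; ring].
Qed.

Lemma Rabs_mult_unit (x r s : R) :
  0 <= r <= 1 -> 0 <= s <= 1 -> Rabs (x * r * s) <= Rabs x.
Proof.
  intros Hr Hs. rewrite Rmult_assoc, Rabs_mult, (Rabs_pos_eq (r * s)) by nra.
  rewrite <- (Rmult_1_r (Rabs x)) at 2.
  apply Rmult_le_compat_l; [apply Rabs_pos | nra].
Qed.

(** * Picard iteration for the integral equation at the singular point *)

Section Frobenius.

Variable Q : R -> R.
Hypothesis Q_even_smooth : even_smooth Q.

(** The equation chi'' + 3 chi'/x = Q chi reads (x^3 chi')' = x^3 Q chi. A first integration from 0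
    gives chi' = x [avg 3] (Q chi), a second one gives chi = chi(0) + [volterra chi]; the weights 3
    and 1 come from these two integrations. *)
Definition volterra (f : R -> R) (x : R) : R :=
  x ^ 2 * avg 1 (avg 3 (fun y => Q y * f y)) x.

Fixpoint picard (k : nat) : R -> R :=
  match k with O => fun _ => 1 | S k' => volterra (picard k') end.

Lemma continuous_Q_mult (f : R -> R) :
  (forall x, continuous f x) -> forall x, continuous (fun y => Q y * f y) x.
Proof.
  intros Hf x. apply (continuous_mult (K := R_AbsRing) Q f); [|apply Hf].
  apply (smooth_R_continuous Q x), Q_even_smooth.
Qed.

Lemma continuous_avg_Q (j : nat) (f : R -> R) :
  (forall x, continuous f x) -> forall x, continuous (avg j (fun y => Q y * f y)) x.
Proof. intros Hf x. apply avg_continuous, continuous_Q_mult, Hf. Qed.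

Lemma continuous_volterra (f : R -> R) :
  (forall x, continuous f x) -> forall x, continuous (volterra f) x.
Proof.
  intros Hf x.
  apply (ex_derive_continuous (volterra f) x).
  exists (x * avg 3 (fun y => Q y * f y) x). apply is_derive_avg_primitive.
  now apply continuous_avg_Q.
Qed.

Lemma volterra_plus (f g : R -> R) (x : R) :
  (forall y, continuous f y) -> (forall y, continuous g y) ->
  volterra (fun y => f y + g y) x = volterra f x + volterra g x.
Proof.
  intros Hf Hg. unfold volterra. rewrite <- Rmult_plus_distr_l. f_equal.
  rewrite <- avg_plus by now apply continuous_avg_Q.
  apply avg_ext. intros r.
  rewrite <- avg_plus by now apply continuous_Q_mult.
  apply avg_ext. intros s. ring.
Qed.

Lemma volterra_bound (f : R -> R) (x M K : R) :
  (forall y, continuous f y) ->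
  (forall y, Rabs y <= Rabs x -> Rabs (Q y) <= M) ->
  (forall y, Rabs y <= Rabs x -> Rabs (f y) <= K) ->
  Rabs (volterra f x) <= x ^ 2 * (M * K).
Proof.
  intros Hf HM HK. unfold volterra.
  rewrite Rabs_mult, Rabs_pos_eq by apply pow2_ge_0.
  apply Rmult_le_compat_l; [apply pow2_ge_0|].
  apply avg_bound; [now apply continuous_avg_Q|].
  intros r Hr. apply avg_bound; [now apply continuous_Q_mult|].
  intros s Hs. rewrite Rabs_mult.
  assert (Rabs (x * r * s) <= Rabs x).
  { now apply Rabs_mult_unit. }
  apply Rmult_le_compat; try apply Rabs_pos; auto.
Qed.

Lemma continuous_picard (k : nat) (x : R) : continuous (picard k) x.
Proof.
  revert x. induction k as [|k IH]; intros x.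
  - apply continuous_const.
  - now apply continuous_volterra.
Qed.

Lemma picard_even (k : nat) (x : R) : picard k (- x) = picard k x.
Proof.
  revert x. induction k as [|k IH]; intros x; [easy|].
  simpl. unfold volterra. f_equal; [ring|].
  apply avg_even. intros y. apply avg_even. intros z.
  now rewrite IH, (proj2 Q_even_smooth).
Qed.

Lemma picard_nonneg (k : nat) (x : R) : (forall y, 0 <= Q y) -> 0 <= picard k x.
Proof.
  intros HQ. revert x. induction k as [|k IH]; intros x; [simpl; lra|].
  simpl. unfold volterra. apply Rmult_le_pos; [apply pow2_ge_0|].
  apply avg_nonneg; [apply continuous_avg_Q, continuous_picard|].
  intros y. apply avg_nonneg; [apply continuous_Q_mult, continuous_picard|].
  intros z. now apply Rmult_le_pos.
Qed.

(** The inner mean is estimated crudely. The outer one, of weight 1, acts on a function bounded by a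
    multiple of r^(2k) and contributes 1/(2k+2), which is at most 1/(k+1): this is the factor that
    turns k! into (k+1)!. *)
Lemma picard_bound (k : nat) (x M : R) :
  (forall y, Rabs y <= Rabs x -> Rabs (Q y) <= M) ->
  Rabs (picard k x) <= (M * x ^ 2) ^ k / INR (Factorial.fact k).
Proof.
  revert x. induction k as [|k IH]; intros x HM.
  { simpl. rewrite Rabs_R1. lra. }
  assert (HM0 : 0 <= M).
  { eapply Rle_trans; [apply Rabs_pos | apply (HM x), Rle_refl]. }
  assert (Hf := INR_fact_lt_0 k).
  simpl picard. unfold volterra.
  rewrite Rabs_mult, Rabs_pos_eq by apply pow2_ge_0.
  assert (B : Rabs (avg 1 (avg 3 (fun y => Q y * picard k y)) x)
              <= (M * ((M * x ^ 2) ^ k / INR (Factorial.fact k))) / INR (S (1 + 2 * k))).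
  { apply avg_bound_pow; [apply continuous_avg_Q, continuous_picard|].
    intros r Hr. apply avg_bound; [apply continuous_Q_mult, continuous_picard|].
    intros s Hs. rewrite Rabs_mult.
    assert (Hxrs : Rabs (x * r * s) <= Rabs x).
    { now apply Rabs_mult_unit. }
    assert (Hp : Rabs (picard k (x * r * s)) <= (M * (x * r * s) ^ 2) ^ k / INR (Factorial.fact k)).
    { apply IH. intros y Hy. apply HM. lra. }
    rewrite (Rmult_assoc M). apply Rmult_le_compat; try apply Rabs_pos; [now apply HM|].
    eapply Rle_trans; [exact Hp|].
    replace ((M * x ^ 2) ^ k / INR (Factorial.fact k) * r ^ (2 * k))
      with ((M * x ^ 2 * r ^ 2) ^ k / INR (Factorial.fact k)).
    2: { rewrite Rpow_mult_distr, pow_mult. field. lra. }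
    apply Rmult_le_compat_r; [left; now apply Rinv_0_lt_compat|].
    apply pow_incr. split; [apply Rmult_le_pos; [easy | apply pow2_ge_0]|].
    rewrite (Rmult_assoc M). apply Rmult_le_compat_l; [easy|].
    rewrite !Rpow_mult_distr.
    assert (0 <= x ^ 2 * r ^ 2) by (apply Rmult_le_pos; apply pow2_ge_0).
    assert (0 <= s ^ 2 <= 1) by (split; [apply pow2_ge_0 | nra]).
    nra. }
  eapply Rle_trans; [apply Rmult_le_compat_l; [apply pow2_ge_0 | exact B]|].
  rewrite fact_simpl, mult_INR.
  assert (Hk : 0 < INR (S k)) by (apply lt_0_INR; lia).
  assert (Hk2 : INR (S k) <= INR (S (1 + 2 * k))) by (apply le_INR; lia).
  set (a := INR (S k)) in *. set (b := INR (S (1 + 2 * k))) in *.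
  replace (x ^ 2 * (M * ((M * x ^ 2) ^ k / INR (Factorial.fact k)) / b))
    with ((M * x ^ 2) ^ S k / INR (Factorial.fact k) * / b) by (simpl; field; lra).
  replace ((M * x ^ 2) ^ S k / (a * INR (Factorial.fact k)))
    with ((M * x ^ 2) ^ S k / INR (Factorial.fact k) * / a) by (field; lra).
  apply Rmult_le_compat_l.
  - apply Rmult_le_pos; [|left; now apply Rinv_0_lt_compat].
    apply pow_le, Rmult_le_pos; [easy | apply pow2_ge_0].
  - now apply Rinv_le_contravar.
Qed.

Lemma Q_bound (r : R) : exists M, forall y, Rabs y <= r -> Rabs (Q y) <= M.
Proof.
  destruct (Rle_lt_dec 0 r) as [Hr|Hr].
  2: { exists 0. intros y Hy. generalize (Rabs_pos y); lra. }
  destruct (continuity_ab_maj (fun y => Rabs (Q y)) (- r) r) as [m [Hm _]]; [lra| |].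
  - intros y _. apply (continuity_pt_comp Q Rabs); [|apply Rcontinuity_abs].
    apply continuity_pt_filterlim, (smooth_R_continuous Q y), Q_even_smooth.
  - exists (Rabs (Q m)). intros y Hy. apply Hm. now apply Rabs_le_between.
Qed.

Definition regular_solution (x : R) : R := Series (fun k => picard k x).

Lemma picard_CVU (r : posreal) :
  CVU (fun n y => sum_f_R0 (fun k => picard k y) n) regular_solution 0 r.
Proof.
  destruct (Q_bound r) as [M HM].
  apply (weierstrass_CVU picard (fun k => (M * r ^ 2) ^ k / INR (Factorial.fact k))).
  - intros k y Hy. unfold Boule in Hy. rewrite Rminus_0_r in Hy.
    eapply Rle_trans; [apply picard_bound with (M := M)|].
    + intros z Hz. apply HM. lra.
    + assert (HM0 : 0 <= M).
      { eapply Rle_trans; [apply Rabs_pos | apply (HM y); lra]. }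
      apply Rmult_le_compat_r; [left; apply Rinv_0_lt_compat, INR_fact_lt_0|].
      apply pow_incr. split; [apply Rmult_le_pos; [easy | apply pow2_ge_0]|].
      apply Rmult_le_compat_l; [easy|].
      rewrite <- (pow2_abs y). apply pow_incr. split; [apply Rabs_pos | lra].
  - exists (exp (M * r ^ 2)).
    apply is_series_ext with (fun k => scal (pow_n (K := R_AbsRing) (M * r ^ 2) k) (/ INR (Factorial.fact k))).
    + intros k. rewrite pow_n_pow. reflexivity.
    + exact (is_exp_Reals (M * r ^ 2)).
Qed.

Lemma continuous_sum_picard (n : nat) (y : R) :
  continuous (fun y => sum_f_R0 (fun k => picard k y) n) y.
Proof.
  induction n as [|n IH]; simpl; [apply continuous_const|].
  apply (continuous_plus (V := R_NormedModule) _ (picard (S n))); [exact IH|].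
  apply continuous_picard.
Qed.

Lemma continuous_regular_solution (x : R) : continuous regular_solution x.
Proof.
  assert (Hr : 0 < Rabs x + 1) by (generalize (Rabs_pos x); lra).
  apply continuity_pt_filterlim.
  apply (CVU_continuity _ _ 0 (mkposreal _ Hr) (picard_CVU (mkposreal _ Hr))).
  - intros n y _. apply continuity_pt_filterlim, continuous_sum_picard.
  - unfold Boule. simpl. rewrite Rminus_0_r. lra.
Qed.

(** The partial sums satisfy s(n+1) = 1 + [volterra] (s n) exactly. Their error [e] is uniformly
    small for |y| <= |x|, so the defect [d] of the limit is at most (1 + x^2 M) eps for every eps.
    The radius |x| + 1 is used because the ball of uniform convergence is open. *)
Lemma regular_solution_volterra (x : R) :
  regular_solution x = 1 + volterra regular_solution x.
Proof.
  assert (Hr : 0 < Rabs x + 1) by (generalize (Rabs_pos x); lra).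
  destruct (Q_bound (Rabs x)) as [M HM].
  assert (HM0 : 0 <= M).
  { eapply Rle_trans; [apply Rabs_pos | apply (HM x), Rle_refl]. }
  set (s := fun n y => sum_f_R0 (fun k => picard k y) n).
  assert (Hs : forall n y, s (S n) y = 1 + volterra (s n) y).
  { induction n as [|n IH]; intros y; [reflexivity|].
    change (s (S (S n)) y) with (s (S n) y + volterra (picard (S n)) y).
    rewrite IH, Rplus_assoc. f_equal.
    rewrite <- (volterra_plus (s n) (picard (S n)));
      [reflexivity | apply continuous_sum_picard | apply continuous_picard]. }
  set (e := fun n y => s n y + -1 * regular_solution y).
  assert (He : forall n y, continuous (e n) y).
  { intros n y. apply (continuous_plus (V := R_NormedModule) (s n) (fun y => -1 * regular_solution y));
      [apply continuous_sum_picard|].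
    apply (continuous_scal_r (V := R_NormedModule) (-1) regular_solution).
    apply continuous_regular_solution. }
  apply Rminus_diag_uniq.
  set (d := regular_solution x - (1 + volterra regular_solution x)).
  assert (Hd : forall eps, 0 < eps -> Rabs d <= (1 + x ^ 2 * M) * eps).
  { intros eps Heps.
    destruct (picard_CVU (mkposreal _ Hr) eps Heps) as [N HN].
    assert (HN' : forall n y, (N <= n)%nat -> Rabs y <= Rabs x -> Rabs (e n y) <= eps).
    { intros n y Hn Hy. left. rewrite <- Rabs_Ropp.
      replace (- e n y) with (regular_solution y - s n y) by (unfold e; ring).
      apply HN; [exact Hn|]. unfold Boule. simpl. rewrite Rminus_0_r. lra. }
    assert (H1 := HN' (S N) x (le_S _ _ (le_n _)) (Rle_refl _)).
    assert (H2 : Rabs (volterra (e N) x) <= x ^ 2 * (M * eps)).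
    { apply volterra_bound; [apply He | exact HM | intros y; now apply HN']. }
    assert (H3 : volterra (s N) x = volterra regular_solution x + volterra (e N) x).
    { rewrite <- volterra_plus; [| apply continuous_regular_solution | apply He].
      unfold volterra. f_equal. apply avg_ext. intros r.
      apply avg_ext. intros t. unfold e. ring. }
    replace d with (- e (S N) x + volterra (e N) x)
      by (unfold d, e at 1; rewrite Hs, H3; ring).
    eapply Rle_trans; [apply Rabs_triang|]. rewrite Rabs_Ropp. lra. }
  destruct (Req_dec d 0) as [H0|H0]; [exact H0 | exfalso].
  assert (Hpos := Rabs_pos_lt d H0).
  assert (HA : 0 < 1 + x ^ 2 * M) by (generalize (Rmult_le_pos _ _ (pow2_ge_0 x) HM0); lra).
  (* With this eps the bound on |d| becomes |d|/2. *)
  specialize (Hd (Rabs d / 2 / (1 + x ^ 2 * M))).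
  replace ((1 + x ^ 2 * M) * (Rabs d / 2 / (1 + x ^ 2 * M))) with (Rabs d / 2) in Hd by (field; lra).
  assert (0 < Rabs d / 2 / (1 + x ^ 2 * M)) by (apply Rdiv_lt_0_compat; lra).
  specialize (Hd H). lra.
Qed.

Lemma is_derive_regular_solution (x : R) :
  is_derive regular_solution x (x * avg 3 (fun y => Q y * regular_solution y) x).
Proof.
  apply is_derive_ext with (fun y => 1 + volterra regular_solution y).
  - intros y. symmetry. apply regular_solution_volterra.
  - rewrite <- (Rplus_0_l (x * _)).
    apply (is_derive_plus (fun _ => 1) (volterra regular_solution)).
    + apply (is_derive_const 1 x).
    + apply is_derive_avg_primitive, continuous_avg_Q, continuous_regular_solution.
Qed.

(** Bootstrap: in chi' = x [avg 3] (Q chi) the right-hand side is C^k as soon as chi is, and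
    continuity of the uniform limit starts the induction. *)
Lemma even_smooth_regular_solution : even_smooth regular_solution.
Proof.
  split.
  - intros k. induction k as [|k IH]; [exact continuous_regular_solution|].
    apply Ck_R_S_intro with (fun x => x * avg 3 (fun y => Q y * regular_solution y) x).
    + apply is_derive_regular_solution.
    + apply Ck_mult; [apply smooth_id|]. apply Ck_avg, Ck_mult; [|exact IH].
      apply Q_even_smooth.
  - intros x. apply Series_ext. intros k. apply picard_even.
Qed.

Lemma regular_solution_0 : regular_solution 0 = 1.
Proof. rewrite regular_solution_volterra. unfold volterra. ring. Qed.

Lemma regular_solution_ge_1 (x : R) : (forall y, 0 <= Q y) -> 1 <= regular_solution x.
Proof.
  intros HQ.
  assert (H0 : forall y, 0 <= regular_solution y).
  { intros y. assert (Hr : 0 < Rabs y + 1) by (generalize (Rabs_pos y); lra).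
    apply Rnot_lt_le. intros Hneg.
    (* If the limit at [y] were negative, an error smaller than its absolute value would force a
       partial sum to be negative, against the sign of the iterates. *)
    destruct (picard_CVU (mkposreal _ Hr) (- regular_solution y)) as [N HN]; [lra|].
    specialize (HN N y (le_n N)). unfold Boule in HN. simpl in HN.
    rewrite Rminus_0_r in HN.
    assert (0 <= sum_f_R0 (fun k => picard k y) N)
      by (apply cond_pos_sum; intros k; now apply picard_nonneg).
    assert (HN' : Rabs (regular_solution y - sum_f_R0 (fun k => picard k y) N) < - regular_solution y)
      by (apply HN; lra).
    apply Rabs_def2 in HN'. lra. }
  rewrite regular_solution_volterra.
  assert (0 <= volterra regular_solution x); [|lra].
  unfold volterra. apply Rmult_le_pos; [apply pow2_ge_0|].
  apply avg_nonneg; [apply continuous_avg_Q, continuous_regular_solution|].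
  intros y. apply avg_nonneg; [apply continuous_Q_mult, continuous_regular_solution|].
  intros z. now apply Rmult_le_pos.
Qed.

End Frobenius.

(** * Comparison with the Sturm-Liouville eigenfunction *)

(* The Sturm-Liouville equation with [P = r psi'] as second unknown. *)
Definition bessel_system (Q y P : R -> R) : Prop :=
  forall r, 0 < r < 1 ->
    is_derive y r (P r / r) /\ is_derive P r ((r * Q r + / r) * y r).

Lemma bessel_system_comb (Q y P z S : R -> R) (K : R) :
  bessel_system Q y P -> bessel_system Q z S ->
  bessel_system Q (fun r => y r - K * z r) (fun r => P r - K * S r).
Proof.
  intros H1 H2 r Hr. destruct (H1 r Hr) as [A1 B1]. destruct (H2 r Hr) as [A2 B2].
  split.
  - replace ((P r - K * S r) / r) with (P r / r - K * (S r / r)) by (field; lra).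
    apply (is_derive_minus y (fun r => K * z r)); [exact A1|].
    now apply (is_derive_scal z).
  - replace ((r * Q r + / r) * (y r - K * z r))
      with ((r * Q r + / r) * y r - K * ((r * Q r + / r) * z r)) by ring.
    apply (is_derive_minus P (fun r => K * S r)); [exact B1|].
    now apply (is_derive_scal S).
Qed.

(** The factor r contained in the second unknowns compensates the 1/r decay of the usual Wronskian:
    the derivative of y S - z P cancels identically. *)
Lemma bessel_wronskian (Q y P z S : R -> R) (a b : R) :
  bessel_system Q y P -> bessel_system Q z S -> 0 < a < 1 -> 0 < b < 1 ->
  y a * S a - z a * P a = y b * S b - z b * P b.
Proof.
  intros H1 H2.
  assert (D : forall r, 0 < r < 1 -> is_derive (fun r => y r * S r - z r * P r) r 0).
  { intros r Hr. destruct (H1 r Hr) as [A1 B1]. destruct (H2 r Hr) as [A2 B2].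
    replace 0 with ((P r / r * S r + y r * ((r * Q r + / r) * z r))
                    - (S r / r * P r + z r * ((r * Q r + / r) * y r))) by (field; lra).
    apply (is_derive_minus (fun r => y r * S r) (fun r => z r * P r)).
    - apply (is_derive_mult y S); [exact A1 | exact B2 | exact Rmult_comm].
    - apply (is_derive_mult z P); [exact A2 | exact B1 | exact Rmult_comm]. }
  assert (L : forall a b, 0 < a < 1 -> 0 < b < 1 -> a < b ->
    y a * S a - z a * P a = y b * S b - z b * P b).
  { intros a' b' Ha Hb Hab.
    apply (eq_is_derive (fun r => y r * S r - z r * P r) a' b'); [|exact Hab].
    intros t Ht. apply D. lra. }
  intros Ha Hb. destruct (Rtotal_order a b) as [H|[H|H]].
  - now apply L.
  - now rewrite H.
  - symmetry. now apply L.
Qed.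

Lemma le_of_derive_nonneg (f df : R -> R) (a b : R) :
  a <= b -> (forall x, a <= x <= b -> is_derive f x (df x)) ->
  (forall x, a <= x <= b -> 0 <= df x) -> f a <= f b.
Proof.
  intros Hab Hd Hpos.
  destruct (MVT_gen f a b df) as [c [Hc E]].
  - intros x Hx. rewrite Rmin_left, Rmax_right in Hx by exact Hab. apply Hd. lra.
  - intros x Hx. rewrite Rmin_left, Rmax_right in Hx by exact Hab.
    apply continuity_pt_filterlim, (ex_derive_continuous f x). exists (df x). now apply Hd.
  - rewrite Rmin_left, Rmax_right in Hc by exact Hab.
    generalize (Rmult_le_pos _ (b - a) (Hpos c Hc)). lra.
Qed.

(** Gronwall for the energy N = y^2 + P^2, whose derivative 2 y P (2/x + x Q) is at most M N in
    absolute value on a compact interval of (0, 1). To the right of [r0] the function N exp(-M x) is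
    nonincreasing, to the left N exp(M x) is nondecreasing; either way N cannot become positive. *)
Lemma bessel_uniqueness (Q y P : R -> R) (r0 r : R) :
  (forall x, continuous Q x) -> bessel_system Q y P ->
  0 < r0 < 1 -> 0 < r < 1 -> y r0 = 0 -> P r0 = 0 -> y r = 0.
Proof.
  intros HQ HS Hr0 Hr Hy HP.
  set (a := Rmin r0 r). set (b := Rmax r0 r).
  assert (Hab : 0 < a <= b /\ b < 1 /\ a <= r0 <= b /\ a <= r <= b).
  { unfold a, b, Rmin, Rmax. destruct (Rle_dec r0 r); lra. }
  destruct (continuity_ab_maj (fun x => Rabs (2 / x + x * Q x)) a b) as [m [Hm _]]; [lra| |].
  { intros x Hx. apply (continuity_pt_comp (fun x => 2 / x + x * Q x) Rabs); [|apply Rcontinuity_abs].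
    apply continuity_pt_filterlim.
    apply (continuous_plus (V := R_NormedModule) (fun x => 2 / x) (fun x => x * Q x)).
    - apply (ex_derive_continuous (fun x => 2 / x)). auto_derive. lra.
    - apply (continuous_mult (K := R_AbsRing) (fun x => x) Q); [apply continuous_id | apply HQ]. }
  set (M := Rabs (2 / m + m * Q m)) in Hm. cbv beta in Hm.
  set (N := fun x => y x ^ 2 + P x ^ 2).
  set (N' := fun x => 2 * (y x * P x) * (2 / x + x * Q x)).
  assert (DN : forall x, a <= x <= b -> is_derive N x (N' x)).
  { intros x Hx. assert (Hx1 : 0 < x < 1) by lra. destruct (HS x Hx1) as [A B].
    unfold N, N'.
    replace (2 * (y x * P x) * (2 / x + x * Q x))
      with (INR 2 * (P x / x) * y x ^ 1 + INR 2 * ((x * Q x + / x) * y x) * P x ^ 1)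
      by (simpl; field; lra).
    apply (is_derive_plus (fun x => y x ^ 2) (fun x => P x ^ 2)).
    - apply (is_derive_pow y 2 x _ A).
    - apply (is_derive_pow P 2 x _ B). }
  assert (BN : forall x, a <= x <= b -> Rabs (N' x) <= M * N x).
  { intros x Hx. unfold N'. rewrite Rabs_mult, Rmult_comm.
    apply Rmult_le_compat; try apply Rabs_pos; [now apply Hm|].
    unfold N. apply Rabs_le.
    generalize (pow2_ge_0 (y x + P x)) (pow2_ge_0 (y x - P x)). split; nra. }
  assert (DE : forall s x, a <= x <= b ->
    is_derive (fun x => N x * exp (s * x)) x ((N' x + s * N x) * exp (s * x))).
  { intros s x Hx.
    replace ((N' x + s * N x) * exp (s * x)) with (N' x * exp (s * x) + N x * (s * exp (s * x))) by ring.
    apply (is_derive_mult N (fun x => exp (s * x))); [now apply DN | | exact Rmult_comm].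
    auto_derive; [easy | ring]. }
  assert (N0 : N r0 = 0) by (unfold N; rewrite Hy, HP; ring).
  assert (Nr : N r <= 0).
  { destruct (Rle_dec r0 r) as [Hle|Hgt].
    - assert (I : - (N r0 * exp (- M * r0)) <= - (N r * exp (- M * r))).
      { apply (le_of_derive_nonneg (fun x => - (N x * exp (- M * x)))
                 (fun x => - ((N' x + - M * N x) * exp (- M * x)))); [exact Hle | |].
        - intros x Hx. apply (is_derive_opp (fun x => N x * exp (- M * x))).
          apply DE. lra.
        - intros x Hx.
          assert (H := BN x ltac:(lra)). apply Rabs_le_between in H.
          generalize (exp_pos (- M * x)). intros He. nra. }
      rewrite N0 in I. generalize (exp_pos (- M * r)). intros He.
      apply Rnot_lt_le. intros Hc. nra.
    - assert (I : N r * exp (M * r) <= N r0 * exp (M * r0)).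
      { apply (le_of_derive_nonneg (fun x => N x * exp (M * x))
                 (fun x => (N' x + M * N x) * exp (M * x))); [lra | |].
        - intros x Hx. apply DE. lra.
        - intros x Hx.
          assert (H := BN x ltac:(lra)). apply Rabs_le_between in H.
          generalize (exp_pos (M * x)). intros He. nra. }
      rewrite N0 in I. generalize (exp_pos (M * r)). intros He.
      apply Rnot_lt_le. intros Hc. nra. }
  unfold N in Nr. generalize (pow2_ge_0 (y r)) (pow2_ge_0 (P r)). intros.
  assert (y r ^ 2 = 0) by lra. nra.
Qed.

Section Matching.

(** [kap] is chi'/x. In these terms chi'' + 3 chi'/x equals 4 kap + x kap', so [chi_ode] is the
    equation for chi with the singular quotient already carried out. *)
Variables Q chi kap kap' : R -> R.
Hypothesis Q_cont : forall x, continuous Q x.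
Hypothesis chi_derive : forall x, is_derive chi x (x * kap x).
Hypothesis kap_derive : forall x, is_derive kap x (kap' x).
Hypothesis chi_ode : forall x, 4 * kap x + x * kap' x = Q x * chi x.
Hypothesis chi_0 : chi 0 = 1.

Lemma bessel_system_regular :
  bessel_system Q (fun r => r * chi r) (fun r => r * (chi r + r ^ 2 * kap r)).
Proof.
  intros r Hr. split.
  - replace (r * (chi r + r ^ 2 * kap r) / r) with (1 * chi r + r * (r * kap r)) by (field; lra).
    apply (is_derive_mult (fun r => r) chi); [apply (is_derive_id (K := R_AbsRing)) | apply chi_derive | exact Rmult_comm].
  - replace ((r * Q r + / r) * (r * chi r))
      with (1 * (chi r + r ^ 2 * kap r) + r * (r * kap r + (2 * r * kap r + r ^ 2 * kap' r)))
      by (replace ((r * Q r + / r) * (r * chi r)) with (r ^ 2 * (Q r * chi r) + chi r) by (field; lra);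
          rewrite <- chi_ode; ring).
    apply (is_derive_mult (fun r => r) (fun r => chi r + r ^ 2 * kap r));
      [apply (is_derive_id (K := R_AbsRing)) | | exact Rmult_comm].
    apply (is_derive_plus chi (fun r => r ^ 2 * kap r)); [apply chi_derive|].
    apply (is_derive_mult (fun r => r ^ 2) kap); [|apply kap_derive | exact Rmult_comm].
    auto_derive; [easy | ring].
Qed.

Lemma chi_near_0 : exists d, 0 < d < 1 /\ forall r, 0 <= r <= d -> 1 / 2 <= chi r <= 2.
Proof.
  assert (Hc : continuity_pt chi 0).
  { apply continuity_pt_filterlim, (ex_derive_continuous chi 0). eexists. apply chi_derive. }
  destruct (Hc (1 / 2)) as [d [Hd H]]; [lra|].
  exists (Rmin (d / 2) (1 / 2)).
  assert (0 < Rmin (d / 2) (1 / 2)) by (apply Rmin_pos; lra).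
  assert (Rmin (d / 2) (1 / 2) <= d / 2) by apply Rmin_l.
  assert (Rmin (d / 2) (1 / 2) <= 1 / 2) by apply Rmin_r.
  split; [lra|]. intros r Hr.
  destruct (Req_dec r 0) as [E|E]; [rewrite E, chi_0; lra|].
  assert (H' : Rabs (chi r - chi 0) < 1 / 2).
  { apply H. split; [split; [exact I | lra]|]. simpl. unfold R_dist.
    rewrite Rminus_0_r, Rabs_pos_eq; lra. }
  apply Rabs_def2 in H'. lra.
Qed.

(* If [c > 0], then [(psi / (r chi))' = c / (r^3 chi^2) >= c / (4 r^3)] forces [psi -> - oo] at [0]. *)
Lemma wronskian_nonpos (psi P : R -> R) (L d0 : R) :
  bessel_system Q psi P -> 0 < d0 < 1 -> (forall r, 0 < r < d0 -> - L <= psi r) ->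
  forall r, 0 < r < 1 ->
  r * chi r * P r - psi r * (r * (chi r + r ^ 2 * kap r)) <= 0.
Proof.
  intros HS Hd0 HL r1 Hr1.
  set (c := r1 * chi r1 * P r1 - psi r1 * (r1 * (chi r1 + r1 ^ 2 * kap r1))).
  apply Rnot_lt_le. intros Hc.
  destruct chi_near_0 as [d [Hd Hchi]].
  assert (W : forall r, 0 < r < 1 -> r * chi r * P r - psi r * (r * (chi r + r ^ 2 * kap r)) = c).
  { intros r Hr. exact (bessel_wronskian Q _ _ _ _ r r1 bessel_system_regular HS Hr Hr1). }
  set (K := psi d / (d * chi d) + c / (8 * d ^ 2)).
  (* The term c/(8 r^2) has derivative -c/(4 r^3), exactly the lower bound available where chi <= 2.
     The sum is therefore nondecreasing on (0, d], and [K] is its value at [d]. *)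
  assert (B : forall r, 0 < r <= d -> psi r / (r * chi r) + c / (8 * r ^ 2) <= K).
  { intros r Hr.
    apply (le_of_derive_nonneg (fun r => psi r / (r * chi r) + c / (8 * r ^ 2))
             (fun r => c / (r ^ 3 * chi r ^ 2) - c / (4 * r ^ 3))); [lra | |].
    - intros x Hx0.
      assert (Hx : 0 < x < 1) by lra. assert (Hcx := Hchi x ltac:(lra)).
      destruct (HS x Hx) as [A _]. destruct (bessel_system_regular x Hx) as [A' _].
      replace (c / (x ^ 3 * chi x ^ 2) - c / (4 * x ^ 3))
        with ((P x / x * (x * chi x) - psi x * (x * (chi x + x ^ 2 * kap x) / x)) / (x * chi x) ^ 2
              + - (c / (4 * x ^ 3)))
        by (rewrite <- (W x Hx); field; lra).
      apply (is_derive_plus (fun r => psi r / (r * chi r)) (fun r => c / (8 * r ^ 2))).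
      + apply (is_derive_div psi (fun r => r * chi r)); [exact A | exact A' |]. apply Rgt_not_eq. nra.
      + auto_derive; [apply Rgt_not_eq; nra | field; lra].
    - intros x Hx0.
      assert (Hcx := Hchi x ltac:(lra)).
      assert (Hx3 : 0 < x ^ 3) by (apply pow_lt; lra).
      apply Rge_le, Rge_minus, Rle_ge.
      apply Rmult_le_compat_l; [lra|]. apply Rinv_le_contravar.
      + apply Rmult_lt_0_compat; [exact Hx3 | apply pow_lt; lra].
      + rewrite (Rmult_comm 4). apply Rmult_le_compat_l; nra. }
  (* At r = e, multiplying [B] by e^2 chi(e) and using chi(e) >= 1/2 gives c/16 <= (|L| + 2|K|) e.
     The last argument of the minimum makes (|L| + 2|K| + 1) e at most c/16, a contradiction. *)
  set (e := Rmin (Rmin d (d0 / 2)) (c / (16 * (Rabs L + 2 * Rabs K + 1)))).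
  assert (HLp := Rabs_pos L). assert (HKp := Rabs_pos K).
  assert (He : 0 < e).
  { apply Rmin_pos; [apply Rmin_pos; lra|]. apply Rdiv_lt_0_compat; lra. }
  assert (He1 : e <= d) by (eapply Rle_trans; [apply Rmin_l | apply Rmin_l]).
  assert (He2 : e <= d0 / 2) by (eapply Rle_trans; [apply Rmin_l | apply Rmin_r]).
  assert (He3 : e * (16 * (Rabs L + 2 * Rabs K + 1)) <= c).
  { apply Rle_div_r; [lra | apply Rmin_r]. }
  assert (Hce := Hchi e ltac:(lra)).
  assert (H1 := B e ltac:(lra)). assert (H2 := HL e ltac:(lra)).
  assert (H3 : psi e * e + c * chi e / 8 <= K * (e ^ 2 * chi e)).
  { replace (psi e * e + c * chi e / 8)
      with ((psi e / (e * chi e) + c / (8 * e ^ 2)) * (e ^ 2 * chi e)) by (field; lra).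
    apply Rmult_le_compat_r; [nra | exact H1]. }
  assert (HL' := Rle_abs L). assert (HK' := Rle_abs K).
  assert (H4 : K * (e ^ 2 * chi e) <= Rabs K * (e * 2)).
  { eapply Rle_trans; [apply Rmult_le_compat_r; [nra | exact HK']|].
    apply Rmult_le_compat_l; [lra|]. nra. }
  assert (H5 : - Rabs L * e <= psi e * e) by (apply Rmult_le_compat_r; lra).
  nra.
Qed.

(** A two-sided bound lets [wronskian_nonpos] be applied to psi and to -psi, so the Wronskian with r
    chi vanishes. For the K that matches psi at one point [d], the difference psi - K r chi then has
    zero Cauchy data there. *)
Lemma bounded_solution_proportional (psi P : R -> R) (L d0 : R) :
  bessel_system Q psi P -> 0 < d0 < 1 -> (forall r, 0 < r < d0 -> Rabs (psi r) <= L) ->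
  exists K, forall r, 0 < r < 1 -> psi r = K * (r * chi r).
Proof.
  intros HS Hd0 HL.
  destruct chi_near_0 as [d [Hd Hchi]].
  assert (Hcd := Hchi d ltac:(lra)).
  assert (W : d * chi d * P d - psi d * (d * (chi d + d ^ 2 * kap d)) = 0).
  { apply Rle_antisym.
    - apply (wronskian_nonpos psi P L d0); try assumption.
      intros r Hr. assert (H := HL r Hr). apply Rabs_le_between in H. lra.
    (* The form [0 - 1 * psi] presents -psi as a combination with the zero solution, as
       [bessel_system_comb] expects. *)
    - assert (HS' : bessel_system Q (fun r => 0 - 1 * psi r) (fun r => 0 - 1 * P r)).
      { apply bessel_system_comb; [|exact HS]. intros r Hr. split.
        - replace (0 / r) with 0 by (field; lra). apply (is_derive_const 0 r).
        - rewrite Rmult_0_r. apply (is_derive_const 0 r). }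
      assert (H := wronskian_nonpos _ _ L d0 HS' Hd0).
      assert (H' := fun h => H h d Hd). cbv beta in H'.
      assert (H'' : forall r, 0 < r < d0 -> - L <= 0 - 1 * psi r).
      { intros r Hr. assert (HB := HL r Hr). apply Rabs_le_between in HB. lra. }
      specialize (H' H''). lra. }
  set (K := psi d / (d * chi d)). exists K. intros r Hr.
  apply Rminus_diag_uniq.
  apply (bessel_uniqueness Q _ _ d r Q_cont (bessel_system_comb Q _ _ _ _ K HS bessel_system_regular) Hd Hr).
  - unfold K. field. lra.
  - unfold K. replace (P d) with (psi d * (d * (chi d + d ^ 2 * kap d)) / (d * chi d)).
    + field. lra.
    + apply (Rmult_eq_reg_r (d * chi d)); [|apply Rgt_not_eq; nra].
      unfold Rdiv. rewrite Rmult_assoc, Rinv_l by (apply Rgt_not_eq; nra). lra.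
Qed.

(** The identity psi = K r chi holds on the open interval and passes to 1 by left continuity. K is
    nonzero because the point where psi does not vanish cannot be 1. *)
Lemma regular_solution_vanishes_at_1 (psi P : R -> R) :
  bessel_system Q psi P -> psi 1 = 0 -> filterlim psi (at_left 1) (locally (psi 1)) ->
  (exists l : R, filterlim psi (at_right 0) (locally l)) ->
  (exists r, 0 < r <= 1 /\ psi r <> 0) -> chi 1 = 0.
Proof.
  intros HS H1 Hlim [l Hl] [r [Hr Hpsi]].
  assert (HB : exists d0, 0 < d0 < 1 /\ forall r, 0 < r < d0 -> Rabs (psi r) <= Rabs l + 1).
  { destruct (proj1 (filterlim_locally psi l) Hl (mkposreal 1 Rlt_0_1)) as [e He].
    exists (Rmin e (1 / 2)).
    assert (0 < Rmin e (1 / 2)) by (apply Rmin_pos; [apply e | lra]).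
    assert (Rmin e (1 / 2) <= e) by apply Rmin_l.
    assert (Rmin e (1 / 2) <= 1 / 2) by apply Rmin_r.
    split; [lra|]. intros x Hx.
    assert (Hx' : Rabs (psi x - l) < 1).
    { apply (He x); [|lra]. change (Rabs (x - 0) < e). rewrite Rminus_0_r, Rabs_pos_eq; lra. }
    replace (psi x) with (psi x - l + l) by ring.
    eapply Rle_trans; [apply Rabs_triang | lra]. }
  destruct HB as [d0 [Hd0 HB]].
  destruct (bounded_solution_proportional psi P _ d0 HS Hd0 HB) as [K HK].
  assert (Hr1 : 0 < r < 1).
  { destruct (Req_dec r 1) as [E|E]; [rewrite E in Hpsi; contradiction | lra]. }
  assert (K0 : K <> 0).
  { intros E. apply Hpsi. rewrite HK, E by assumption. ring. }
  assert (Hlim' : filterlim psi (at_left 1) (locally (K * (1 * chi 1)))).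
  { apply filterlim_ext_loc with (fun r => K * (r * chi r)).
    - exists (mkposreal 1 Rlt_0_1). intros x Hx Hx1. symmetry. apply HK.
      change (Rabs (x - 1) < 1) in Hx. apply Rabs_def2 in Hx. lra.
    - eapply filterlim_filter_le_1; [apply filter_le_within|].
      assert (Hc : continuous (fun r => K * (r * chi r)) 1); [|exact Hc].
      apply (continuous_scal_r (V := R_NormedModule) K (fun r => r * chi r)).
      apply (continuous_mult (K := R_AbsRing) (fun r => r) chi); [apply continuous_id|].
      apply (ex_derive_continuous chi 1). eexists. apply chi_derive. }
  assert (E := filterlim_locally_unique psi _ _ Hlim Hlim').
  rewrite H1 in E. apply (Rmult_eq_reg_l K); [lra | exact K0].
Qed.

End Matching.

(** * Radial functions *)

Lemma is_linear_px : is_linear (fun p : pt => px p).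
Proof.
  apply (is_linear_comp (fun p : pt => fst p) (fun q : R * R => fst q));
    apply is_linear_fst.
Qed.

Lemma is_linear_py : is_linear (fun p : pt => py p).
Proof.
  apply (is_linear_comp (fun p : pt => fst p) (fun q : R * R => snd q));
    [apply is_linear_fst | apply is_linear_snd].
Qed.

Lemma is_linear_pz : is_linear (fun p : pt => pz p).
Proof. apply is_linear_snd. Qed.

Lemma radius_sqr (p : pt) : radius p ^ 2 = px p ^ 2 + py p ^ 2.
Proof.
  unfold radius. simpl pow. rewrite !Rmult_1_r. apply sqrt_sqrt.
  generalize (pow2_ge_0 (px p)) (pow2_ge_0 (py p)). simpl. lra.
Qed.

Lemma radius_nonneg (p : pt) : 0 <= radius p.
Proof. apply sqrt_pos. Qed.

Lemma continuous_radius (p : pt) : continuous radius p.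
Proof.
  apply (continuous_comp (fun p : pt => px p ^ 2 + py p ^ 2) sqrt); [|apply continuous_sqrt].
  assert (H : smooth (fun p : pt => px p * px p + py p * py p)).
  { apply smooth_plus; apply smooth_mult; apply smooth_linear;
      first [apply is_linear_px | apply is_linear_py]. }
  apply continuous_ext with (fun p : pt => px p * px p + py p * py p).
  - intros q. simpl. ring.
  - apply (H 0%nat).
Qed.

(* At the axis, evenness of [f] removes the singularity of the radius. *)
Lemma is_dirD_radial (f k : R -> R) (p v : pt) :
  (forall x, f (- x) = f x) -> (forall x, is_derive f x (x * k x)) ->
  is_dirD (fun q : pt => f (radius q)) p v ((px p * px v + py p * py v) * k (radius p)).
Proof.
  intros He Hd. unfold is_dirD.
  apply is_derive_ext with (fun s =>
    f (sqrt ((px p + s * px v) ^ 2 + (py p + s * py v) ^ 2))); [reflexivity|].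
  destruct (Req_dec (radius p) 0) as [H0|H0].
  - assert (H := radius_sqr p). rewrite H0 in H.
    generalize (pow2_ge_0 (px p)) (pow2_ge_0 (py p)). intros.
    assert (Hx : px p = 0) by (apply Rsqr_0_uniq; unfold Rsqr; simpl in *; lra).
    assert (Hy : py p = 0) by (apply Rsqr_0_uniq; unfold Rsqr; simpl in *; lra).
    rewrite Hx, Hy. set (m := sqrt (px v ^ 2 + py v ^ 2)).
    apply is_derive_ext with (fun s => f (s * m)).
    + intros s. replace ((0 + s * px v) ^ 2 + (0 + s * py v) ^ 2)
        with (s ^ 2 * (px v ^ 2 + py v ^ 2)) by ring.
      rewrite sqrt_mult_alt by apply pow2_ge_0. fold m.
      rewrite <- Rsqr_pow2, sqrt_Rsqr_abs.
      unfold Rabs. destruct (Rcase_abs s); [|reflexivity].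
      rewrite <- He. f_equal. ring.
    + replace ((0 * px v + 0 * py v) * k (radius p)) with (m * ((0 * m) * k (0 * m))) by ring.
      apply (is_derive_comp f (fun s => s * m)); [apply Hd|].
      auto_derive; [easy | ring].
  - assert (Hpos : 0 < px p ^ 2 + py p ^ 2).
    { rewrite <- radius_sqr. generalize (pow2_gt_0 _ H0). easy. }
    replace ((px p * px v + py p * py v) * k (radius p))
      with ((px p * px v + py p * py v) / radius p * (radius p * k (radius p))) by (now field).
    assert (Hr : radius p = sqrt ((px p + 0 * px v) ^ 2 + (py p + 0 * py v) ^ 2)).
    { unfold radius. f_equal. ring. }
    apply (is_derive_comp f (fun s => sqrt ((px p + s * px v) ^ 2 + (py p + s * py v) ^ 2))).
    + rewrite <- Hr. apply Hd.
    + auto_derive.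
      * simpl in Hpos.
        replace ((px p + 0 * px v) * ((px p + 0 * px v) * 1) + (py p + 0 * py v) * ((py p + 0 * py v) * 1))
          with (px p * (px p * 1) + py p * (py p * 1)) by ring. exact Hpos.
      * match goal with |- context [sqrt ?a] =>
          replace (sqrt a) with (radius p) by (unfold radius; f_equal; ring) end.
        field. exact H0.
Qed.

(** A directional derivative of f(radius) is a linear function of the position times
    [reduced_derive f] of the radius. That function is again smooth and even, so the induction on
    the order must leave [f] free. *)
Lemma smooth_radial (f : R -> R) : even_smooth f -> smooth (fun p : pt => f (radius p)).
Proof.
  intros Hf k. revert f Hf. induction k as [|k IH]; intros f Hf.
  - intros p. apply (continuous_comp radius f); [apply continuous_radius|].
    apply (smooth_R_continuous f), Hf.
  - apply Ck_S_intro with (fun v p => (px p * px v + py p * py v) * reduced_derive f (radius p)).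
    + intros p. apply (continuous_comp radius f); [apply continuous_radius|].
      apply (smooth_R_continuous f), Hf.
    + intros p v. apply is_dirD_radial; [apply Hf|]. intros x. now apply reduced_derive_spec.
    + intros v. apply Ck_mult.
      * apply Ck_plus; (apply Ck_mult; [apply Ck_linear | apply Ck_const]);
          [apply is_linear_px | apply is_linear_py].
      * now apply IH, even_smooth_reduced_derive.
Qed.

Lemma even_smooth_const (c : R) : even_smooth (fun _ => c).
Proof. split; [apply smooth_const | easy]. Qed.

Lemma even_smooth_sqr : even_smooth (fun x => x ^ 2).
Proof.
  split; [|intros x; ring].
  intros k. apply Ck_ext with (fun x => x * x); [intros; ring|].
  apply smooth_mult; apply smooth_id.
Qed.

Lemma even_smooth_plus (f g : R -> R) :
  even_smooth f -> even_smooth g -> even_smooth (fun x => f x + g x).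
Proof.
  intros [Hf Ef] [Hg Eg]. split; [now apply smooth_plus|].
  intros x. now rewrite Ef, Eg.
Qed.

Lemma even_smooth_mult (f g : R -> R) :
  even_smooth f -> even_smooth g -> even_smooth (fun x => f x * g x).
Proof.
  intros [Hf Ef] [Hg Eg]. split; [now apply smooth_mult|].
  intros x. now rewrite Ef, Eg.
Qed.

Lemma even_smooth_avg (j : nat) (g : R -> R) : even_smooth g -> even_smooth (avg j g).
Proof.
  intros [Hg Eg]. split; [now apply smooth_avg|]. intros x. now apply avg_even.
Qed.

Lemma continuous_eq_at_0 (f g : R -> R) :
  continuous f 0 -> continuous g 0 -> (forall x, x <> 0 -> f x = g x) -> f 0 = g 0.
Proof.
  intros Hf Hg H.
  apply (filterlim_locally_unique (F := at_right 0) f).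
  - eapply filterlim_filter_le_1; [apply filter_le_within | exact Hf].
  - apply filterlim_ext_loc with g.
    + exists (mkposreal 1 Rlt_0_1). intros x _ Hx. symmetry. apply H. lra.
    + eapply filterlim_filter_le_1; [apply filter_le_within | exact Hg].
Qed.

(* On the line [y = z = 0] the second component of the swirl is [u |x| x]; Hadamard divides by [x]. *)
Lemma even_smooth_swirl_profile (u : R -> R) :
  smooth u -> vector_field (swirl u) -> even_smooth (fun x => u (Rabs x)).
Proof.
  intros Hu [[_ [Hy _]] _].
  split; [|intros x; now rewrite Rabs_Ropp].
  set (f := fun x : R => u (Rabs x) * x).
  assert (Hl : is_linear (fun x : R => (x, 0, 0) : pt)).
  { apply (is_linear_prod (fun x : R => (x, 0)) (fun _ : R => 0)); [|exact (is_linear_zero (U := R_NormedModule) (V := R_NormedModule))].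
    apply (is_linear_prod (fun x : R => x) (fun _ : R => 0)); [apply is_linear_id | exact (is_linear_zero (U := R_NormedModule) (V := R_NormedModule))]. }
  assert (Hf : smooth f).
  { intros k.
    apply Ck_ext with (fun x : R => py (swirl u (x, 0, 0))).
    - intros x. unfold swirl, radius, E, f, px, py; simpl.
      rewrite Rmult_0_l, Rplus_0_r, Rmult_1_r.
      change (x * x) with (Rsqr x). now rewrite sqrt_Rsqr_abs.
    - exact (Ck_comp_linear k _ (fun p => py (swirl u p)) Hl (Hy k)). }
  assert (Hne : forall x, x <> 0 -> u (Rabs x) = avg 0 (Derive f) x).
  { intros x Hx. apply (Rmult_eq_reg_l x); [|exact Hx].
    rewrite <- hadamard by exact Hf. unfold f. ring. }
  assert (Ha : smooth (avg 0 (Derive f))) by now apply smooth_avg, smooth_Derive.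
  intros k. apply Ck_ext with (avg 0 (Derive f)); [|apply Ha].
  intros x. destruct (Req_dec x 0) as [E0|E0]; [|symmetry; now apply Hne].
  rewrite E0. symmetry.
  apply (continuous_eq_at_0 (fun x => u (Rabs x))); [| |exact Hne].
  - apply (continuous_comp Rabs u); [apply continuous_Rabs | now apply (smooth_R_continuous u)].
  - now apply (smooth_R_continuous (avg 0 (Derive f))).
Qed.

(** * Axisymmetric waves *)

Lemma is_dirD_eq {U : NormedModule R_AbsRing} (f : U -> R) (p v : U) (a b : R) :
  is_dirD f p v a -> a = b -> is_dirD f p v b.
Proof. now intros H <-. Qed.

Lemma is_dirD_cos_pz (nu : R) (p v : pt) :
  is_dirD (fun q : pt => cos (nu * pz q)) p v (nu * pz v * - sin (nu * pz p)).
Proof.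
  refine (is_dirD_eq _ _ _ _ _ (is_dirD_comp (fun z => cos (nu * z)) (fun q : pt => pz q) p v
    (pz v) (- nu * sin (nu * pz p)) _ _) _).
  - auto_derive; [easy | ring].
  - apply is_dirD_linear, is_linear_pz.
  - ring.
Qed.

Lemma is_dirD_sin_pz (nu : R) (p v : pt) :
  is_dirD (fun q : pt => sin (nu * pz q)) p v (nu * pz v * cos (nu * pz p)).
Proof.
  refine (is_dirD_eq _ _ _ _ _ (is_dirD_comp (fun z => sin (nu * z)) (fun q : pt => pz q) p v
    (pz v) (nu * cos (nu * pz p)) _ _) _).
  - auto_derive; [easy | ring].
  - apply is_dirD_linear, is_linear_pz.
  - ring.
Qed.

Lemma dvec_intro {U : NormedModule R_AbsRing} (F : U -> pt) (p v : U) (a b c : R) :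
  is_dirD (fun q => px (F q)) p v a -> is_dirD (fun q => py (F q)) p v b ->
  is_dirD (fun q => pz (F q)) p v c -> dvec F p v = (a, b, c).
Proof.
  intros Ha Hb Hc. unfold dvec.
  now rewrite (dirD_unique _ _ _ _ Ha), (dirD_unique _ _ _ _ Hb), (dirD_unique _ _ _ _ Hc).
Qed.

Lemma pt_ext (p q : pt) : px p = px q -> py p = py q -> pz p = pz q -> p = q.
Proof.
  destruct p as [[? ?] ?], q as [[? ?] ?]. unfold px, py, pz; simpl. congruence.
Qed.

Lemma smooth_map_is_dirD {U : NormedModule R_AbsRing} (F : U -> pt) (p v : U) :
  smooth_map F ->
  is_dirD (fun q => px (F q)) p v (px (dvec F p v)) /\
  is_dirD (fun q => py (F q)) p v (py (dvec F p v)) /\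
  is_dirD (fun q => pz (F q)) p v (pz (dvec F p v)).
Proof.
  intros [H1 [H2 H3]]. split; [|split].
  - exact (Ck_S_dirD 0 _ p v (H1 1%nat)).
  - exact (Ck_S_dirD 0 _ p v (H2 1%nat)).
  - exact (Ck_S_dirD 0 _ p v (H3 1%nat)).
Qed.

Lemma divergence_vsub (F G : pt -> pt) (p : pt) :
  smooth_map F -> smooth_map G ->
  divergence (fun q => vsub (F q) (G q)) p = divergence F p - divergence G p.
Proof.
  intros HF HG.
  assert (D : forall v, dvec (fun q => vsub (F q) (G q)) p v = vsub (dvec F p v) (dvec G p v)).
  { intros v. destruct (smooth_map_is_dirD F p v HF) as [F1 [F2 F3]].
    destruct (smooth_map_is_dirD G p v HG) as [G1 [G2 G3]].
    apply dvec_intro.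
    - exact (is_dirD_minus _ _ _ _ _ _ F1 G1).
    - exact (is_dirD_minus _ _ _ _ _ _ F2 G2).
    - exact (is_dirD_minus _ _ _ _ _ _ F3 G3). }
  unfold divergence. rewrite !D. unfold vsub, px, py, pz; simpl. ring.
Qed.

Lemma smooth_map_grad (q : pt -> R) : smooth q -> smooth_map (grad q).
Proof.
  intros H. split; [|split]; intros k.
  - apply (H (S k)).
  - apply (H (S k)).
  - apply (H (S k)).
Qed.

Lemma radius_same_pt (p p' : pt) : same_pt p p' -> radius p' = radius p.
Proof. intros [Hx [Hy _]]. unfold radius. now rewrite Hx, Hy. Qed.

Lemma cos_sin_periodic_Z (x : R) (k : Z) :
  cos (x + 2 * PI * IZR k) = cos x /\ sin (x + 2 * PI * IZR k) = sin x.
Proof.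
  destruct (Z_le_gt_dec 0 k) as [Hk|Hk].
  - replace (x + 2 * PI * IZR k) with (x + 2 * INR (Z.to_nat k) * PI)
      by (rewrite INR_IZR_INZ, Z2Nat.id by exact Hk; ring).
    split; [apply cos_period | apply sin_period].
  - set (y := x + 2 * PI * IZR k).
    replace x with (y + 2 * INR (Z.to_nat (- k)) * PI)
      by (unfold y; rewrite INR_IZR_INZ, Z2Nat.id, opp_IZR by lia; ring).
    split; [now rewrite cos_period | now rewrite sin_period].
Qed.

Lemma cos_sin_same_pt (n : nat) (p p' : pt) :
  same_pt p p' ->
  cos (INR n * pz p') = cos (INR n * pz p) /\ sin (INR n * pz p') = sin (INR n * pz p).
Proof.
  intros [_ [_ [k Hk]]]. rewrite Hk.
  replace (INR n * (pz p + 2 * PI * IZR k))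
    with (INR n * pz p + 2 * PI * IZR (Z.of_nat n * k)).
  - apply cos_sin_periodic_Z.
  - rewrite mult_IZR, <- INR_IZR_INZ. ring.
Qed.

(** The derivative is an existential variable that the rules fill in; [ring] then compares it with
    the expected formula. The radial case is closed by [eauto], which explains why evenness and
    derivative facts are put into the context before each call. *)
Ltac dir :=
  lazymatch goal with
  | |- is_dirD (fun q => @?f q + @?g q) _ _ _ => apply (is_dirD_plus f g); dir
  | |- is_dirD (fun q => @?f q - @?g q) _ _ _ => apply (is_dirD_minus f g); dir
  | |- is_dirD (fun q => @?f q * @?g q) _ _ _ => apply (is_dirD_mult f g); dir
  | |- is_dirD (fun q => px q) _ _ _ => exact (is_dirD_linear _ _ _ is_linear_px)
  | |- is_dirD (fun q => py q) _ _ _ => exact (is_dirD_linear _ _ _ is_linear_py)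
  | |- is_dirD (fun q => pz q) _ _ _ => exact (is_dirD_linear _ _ _ is_linear_pz)
  | |- is_dirD (fun q => cos (?nu * pz q)) _ _ _ => exact (is_dirD_cos_pz nu _ _)
  | |- is_dirD (fun q => sin (?nu * pz q)) _ _ _ => exact (is_dirD_sin_pz nu _ _)
  | |- is_dirD (fun q => ?f (radius q)) _ _ _ => eapply (is_dirD_radial f); solve [eauto]
  | |- is_dirD (fun q => ?c) _ _ _ => exact (is_dirD_const c _ _)
  end.

Lemma dvec_E (p v : pt) : dvec E p v = (- py v, px v, 0).
Proof.
  apply dvec_intro.
  - apply is_dirD_ext with (fun q : pt => 0 - py q).
    + intros q. unfold E, px at 1; simpl. ring.
    + eapply is_dirD_eq; [dir | ring].
  - change (is_dirD (fun q : pt => px q) p v (px v)). dir.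
  - change (is_dirD (fun _ : pt => 0) p v 0). dir.
Qed.

Definition swirl_field (U : R -> R) (p : pt) : pt :=
  (- (py p * U (radius p)), px p * U (radius p), 0).

Lemma swirl_eq (u : R -> R) : swirl u = swirl_field (fun x => u (Rabs x)).
Proof.
  apply functional_extensionality. intros p.
  unfold swirl, swirl_field. rewrite Rabs_pos_eq by apply radius_nonneg.
  apply pt_ext; unfold E, px, py, pz; simpl; ring.
Qed.

Lemma dvec_swirl_field (U U1 : R -> R) (p v : pt) :
  (forall x, U (- x) = U x) -> (forall x, is_derive U x (x * U1 x)) ->
  dvec (swirl_field U) p v =
  (- (py v * U (radius p) + py p * ((px p * px v + py p * py v) * U1 (radius p))),
   px v * U (radius p) + px p * ((px p * px v + py p * py v) * U1 (radius p)), 0).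
Proof.
  intros He Hd. apply dvec_intro.
  - apply is_dirD_ext with (fun q => 0 - py q * U (radius q)).
    + intros q. unfold swirl_field, px; simpl. ring.
    + eapply is_dirD_eq; [dir | ring].
  - apply is_dirD_ext with (fun q => px q * U (radius q)); [reflexivity|].
    eapply is_dirD_eq; [dir | ring].
  - change (is_dirD (fun _ : pt => 0) p v 0). dir.
Qed.

Section Wave.

Variables (n : nat) (Q chi kap kap' : R -> R).
Hypothesis chi_even_smooth : even_smooth chi.
Hypothesis kap_even_smooth : even_smooth kap.
Hypothesis chi_derive : forall x, is_derive chi x (x * kap x).
Hypothesis kap_derive : forall x, is_derive kap x (kap' x).
Hypothesis chi_ode : forall x, 4 * kap x + x * kap' x = Q x * chi x.
Hypothesis chi_1 : chi 1 = 0.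

Let nu := INR n.

(* With [psi = r chi], this is [psi' + psi / r]. *)
Definition axial (x : R) : R := 2 * chi x + x ^ 2 * kap x.

Lemma even_smooth_axial : even_smooth axial.
Proof.
  apply even_smooth_plus; apply even_smooth_mult;
    first [assumption | apply even_smooth_const | apply even_smooth_sqr].
Qed.

Lemma axial_even (x : R) : axial (- x) = axial x.
Proof. apply even_smooth_axial. Qed.

Lemma chi_even (x : R) : chi (- x) = chi x.
Proof. apply chi_even_smooth. Qed.

(** For psi = r chi this is (psi' + psi/r)' = Q psi, the radial equation itself; through this
    derivative the eigenvalue problem enters the vector calculus. *)
Lemma axial_derive (x : R) : is_derive axial x (x * (Q x * chi x)).
Proof.
  rewrite <- chi_ode.
  replace (x * (4 * kap x + x * kap' x))
    with (2 * (x * kap x) + (2 * x * kap x + x ^ 2 * kap' x)) by ring.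
  apply (is_derive_plus (fun x => 2 * chi x) (fun x => x ^ 2 * kap x)).
  - now apply (is_derive_scal chi).
  - apply (is_derive_mult (fun x => x ^ 2) kap); [|apply kap_derive | exact Rmult_comm].
    auto_derive; [easy | ring].
Qed.

(* [alpha] times the field with stream function [r psi sin (n z)], plus a swirl of
   amplitude [beta G chi cos (n z)]. *)
Definition wave (G : R -> R) (alpha beta : R) (p : pt) : pt :=
  (alpha * (- nu * px p * chi (radius p) * cos (nu * pz p))
     - beta * (py p * G (radius p) * chi (radius p) * cos (nu * pz p)),
   alpha * (- nu * py p * chi (radius p) * cos (nu * pz p))
     + beta * (px p * G (radius p) * chi (radius p) * cos (nu * pz p)),
   alpha * (axial (radius p) * sin (nu * pz p))).

Lemma dvec_wave (G G1 : R -> R) (alpha beta : R) (p v : pt) :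
  (forall x, G (- x) = G x) -> (forall x, is_derive G x (x * G1 x)) ->
  let m := px p * px v + py p * py v in
  let C := chi (radius p) in
  let K := kap (radius p) in
  let g := G (radius p) in
  let c := cos (nu * pz p) in
  let s := sin (nu * pz p) in
  dvec (wave G alpha beta) p v =
  (alpha * (- nu * (px v * C * c + px p * (m * K) * c - px p * C * (nu * pz v * s)))
     - beta * (py v * g * C * c + py p * (m * G1 (radius p)) * C * c + py p * g * (m * K) * c
               - py p * g * C * (nu * pz v * s)),
   alpha * (- nu * (py v * C * c + py p * (m * K) * c - py p * C * (nu * pz v * s)))
     + beta * (px v * g * C * c + px p * (m * G1 (radius p)) * C * c + px p * g * (m * K) * c
               - px p * g * C * (nu * pz v * s)),
   alpha * (m * (Q (radius p) * C) * s + axial (radius p) * (nu * pz v * c))).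
Proof.
  intros HG HG1. cbv zeta.
  pose proof chi_even. pose proof axial_even.
  (* Naming the product gives the derivative of [axial] the shape [x * k x] that the radial rule
     unifies with. *)
  set (k := fun x => Q x * chi x).
  assert (forall x, is_derive axial x (x * k x)) by exact axial_derive.
  apply dvec_intro.
  - eapply (is_dirD_eq (fun q : pt =>
      alpha * (- nu * px q * chi (radius q) * cos (nu * pz q))
      - beta * (py q * G (radius q) * chi (radius q) * cos (nu * pz q)))); [dir | ring].
  - eapply (is_dirD_eq (fun q : pt =>
      alpha * (- nu * py q * chi (radius q) * cos (nu * pz q))
      + beta * (px q * G (radius q) * chi (radius q) * cos (nu * pz q)))); [dir | ring].
  - eapply (is_dirD_eq (fun q : pt => alpha * (axial (radius q) * sin (nu * pz q)))); [dir | unfold k; ring].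
Qed.


(** The linear map [l] allows one proof to cover a field at fixed time ([l] the identity) and a
    curve of fields ([l] the projection of space-time onto space). *)
Lemma smooth_map_wave {U : NormedModule R_AbsRing} (l : U -> pt) (alpha beta : U -> R) (G : R -> R) :
  is_linear l -> smooth alpha -> smooth beta -> even_smooth G ->
  smooth_map (fun a => wave G (alpha a) (beta a) (l a)).
Proof.
  intros Hl Ha Hb HG.
  assert (Sx : smooth (fun a => px (l a)))
    by exact (smooth_comp_linear l (fun p : pt => px p) Hl (smooth_linear _ is_linear_px)).
  assert (Sy : smooth (fun a => py (l a)))
    by exact (smooth_comp_linear l (fun p : pt => py p) Hl (smooth_linear _ is_linear_py)).
  assert (Sz : smooth (fun a => nu * pz (l a))).
  { apply smooth_mult; [apply smooth_const|].
    exact (smooth_comp_linear l (fun p : pt => pz p) Hl (smooth_linear _ is_linear_pz)). }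
  assert (Sr : forall f, even_smooth f -> smooth (fun a => f (radius (l a)))).
  { intros f Hf. exact (smooth_comp_linear l (fun p : pt => f (radius p)) Hl (smooth_radial f Hf)). }
  assert (Sc : smooth (fun a => cos (nu * pz (l a))))
    by exact (smooth_comp cos _ (proj1 smooth_cos_sin) Sz).
  assert (Ss : smooth (fun a => sin (nu * pz (l a))))
    by exact (smooth_comp sin _ (proj2 smooth_cos_sin) Sz).
  assert (SC := Sr chi chi_even_smooth). assert (SG := Sr G HG).
  assert (SH := Sr axial even_smooth_axial).
  split; [|split].
  - change (smooth (fun a =>
      alpha a * (- nu * px (l a) * chi (radius (l a)) * cos (nu * pz (l a)))
      - beta a * (py (l a) * G (radius (l a)) * chi (radius (l a)) * cos (nu * pz (l a))))).
    apply smooth_minus; apply smooth_mult; [exact Ha | | exact Hb |];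
      (repeat apply smooth_mult); try apply smooth_const; assumption.
  - change (smooth (fun a =>
      alpha a * (- nu * py (l a) * chi (radius (l a)) * cos (nu * pz (l a)))
      + beta a * (px (l a) * G (radius (l a)) * chi (radius (l a)) * cos (nu * pz (l a))))).
    apply smooth_plus; apply smooth_mult; [exact Ha | | exact Hb |];
      (repeat apply smooth_mult); try apply smooth_const; assumption.
  - change (smooth (fun a => alpha a * (axial (radius (l a)) * sin (nu * pz (l a))))).
    apply smooth_mult; [exact Ha | now apply smooth_mult].
Qed.

Lemma smooth_curve_wave (G alpha beta : R -> R) :
  smooth alpha -> smooth beta -> even_smooth G ->
  smooth_curve (fun t => wave G (alpha t) (beta t)).
Proof.
  intros Ha Hb HG.
  apply (smooth_map_wave (fun a : R * pt => snd a) (fun a => alpha (fst a)) (fun a => beta (fst a)) G).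
  - apply is_linear_snd.
  - exact (smooth_comp_linear (fun a : R * pt => fst a) alpha is_linear_fst Ha).
  - exact (smooth_comp_linear (fun a : R * pt => fst a) beta is_linear_fst Hb).
  - exact HG.
Qed.

Lemma dt_wave (G alpha beta alpha' beta' : R -> R) (t : R) (p : pt) :
  is_derive alpha t (alpha' t) -> is_derive beta t (beta' t) ->
  dt (fun t => wave G (alpha t) (beta t)) t p = wave G (alpha' t) (beta' t) p.
Proof.
  intros Ha Hb. apply dirD_R_1 in Ha. apply dirD_R_1 in Hb.
  assert (L : forall x y, is_dirD (fun s => alpha s * x + beta s * y) t 1 (alpha' t * x + beta' t * y)).
  { intros x y.
    refine (is_dirD_eq _ _ _ _ _ (is_dirD_plus (fun s => alpha s * x) (fun s => beta s * y) t 1 _ _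
      (is_dirD_mult alpha (fun _ => x) t 1 _ _ Ha (is_dirD_const x t 1))
      (is_dirD_mult beta (fun _ => y) t 1 _ _ Hb (is_dirD_const y t 1))) _). ring. }
  unfold dt. apply dvec_intro.
  - refine (is_dirD_eq _ _ _ _ _ (is_dirD_ext _ _ _ _ _ _ (L
      (- nu * px p * chi (radius p) * cos (nu * pz p))
      (- (py p * G (radius p) * chi (radius p) * cos (nu * pz p))))) _).
    + intros s. unfold wave. change px with (fun p : pt => fst (fst p)) at 2. simpl. ring.
    + ring.
  - exact (L _ _).
  - refine (is_dirD_eq _ _ _ _ _ (is_dirD_ext _ _ _ _ _ _ (L
      (axial (radius p) * sin (nu * pz p)) 0)) _).
    + intros s. unfold wave. change pz with (fun p : pt => snd p) at 2. simpl. ring.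
    + ring.
Qed.

(** The meridional part comes from a stream function and the swirl has axisymmetric amplitude, so
    the divergence cancels. The normal component at the boundary contains chi(1) = 0. The bracket
    with [E] vanishes because the cylindrical components depend on r and z only. *)
Lemma tangent_id_wave (G : R -> R) (alpha beta : R) :
  even_smooth G -> tangent_id (wave G alpha beta).
Proof.
  intros HG.
  assert (D := fun p v => dvec_wave G (reduced_derive G) alpha beta p v (proj2 HG)
                 (fun x => reduced_derive_spec G x HG)).
  cbv zeta in D.
  repeat split.
  - apply (smooth_map_wave (fun p : pt => p) (fun _ => alpha) (fun _ => beta) G
             (is_linear_id (V := prod_NormedModule _ _ _)) (smooth_const _) (smooth_const _) HG).
  - apply (smooth_map_wave (fun p : pt => p) (fun _ => alpha) (fun _ => beta) G
             (is_linear_id (V := prod_NormedModule _ _ _)) (smooth_const _) (smooth_const _) HG).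
  - apply (smooth_map_wave (fun p : pt => p) (fun _ => alpha) (fun _ => beta) G
             (is_linear_id (V := prod_NormedModule _ _ _)) (smooth_const _) (smooth_const _) HG).
  - intros p p' _ Hp. unfold wave, nu.
    destruct (cos_sin_same_pt n p p' Hp) as [-> ->]. rewrite (radius_same_pt p p' Hp).
    destruct Hp as [-> [-> _]]. reflexivity.
  - intros p _. unfold divergence. rewrite !D.
    unfold axial, e_x, e_y, e_z, px at 1, py at 2, pz at 3; cbn [fst snd].
    rewrite radius_sqr. unfold px, py, pz; cbn [fst snd]. ring.
  - intros p Hp. unfold in_bdM in Hp.
    assert (Hr : radius p = 1) by (unfold radius; rewrite Hp; apply sqrt_1).
    unfold wave, dot, normal. rewrite Hr, chi_1.
    unfold px, py, pz; cbn [fst snd]. ring.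
  - intros p _. unfold bracket, nabla. rewrite D, dvec_E.
    apply pt_ext; unfold vsub, vzero, wave, E, px, py, pz; cbn [fst snd]; ring.
Qed.

(** * The steady swirl and the linearised Euler operator on waves *)

Variables (U U1 : R -> R) (lambda : R).
Hypothesis U_even_smooth : even_smooth U.
Hypothesis U1_even_smooth : even_smooth U1.
Hypothesis U_derive : forall x, is_derive U x (x * U1 x).
Hypothesis lambda_nonzero : lambda <> 0.
Hypothesis nu_nonzero : nu <> 0.

(** This is 2u + r u' with r u' written as r^2 [U1], so that it is smooth and even on the whole
    line. *)
Definition vorticity (x : R) : R := 2 * U x + x ^ 2 * U1 x.

Hypothesis Q_eq : forall x, Q x = nu ^ 2 - 2 * lambda ^ 2 * (U x * vorticity x).

Lemma even_smooth_vorticity : even_smooth vorticity.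
Proof.
  apply even_smooth_plus; apply even_smooth_mult;
    first [assumption | apply even_smooth_const | apply even_smooth_sqr].
Qed.

(** For an axisymmetric field W one has [u d/dtheta, W] = -W(u) d/dtheta. Only the radial component
    of W contributes, namely -n alpha r chi cos(n z), and u' = r [U1]. *)
Lemma bracket_swirl_wave (G : R -> R) (alpha beta : R) (p : pt) :
  even_smooth G ->
  bracket (swirl_field U) (wave G alpha beta) p = wave (fun x => x ^ 2 * U1 x) 0 (nu * alpha) p.
Proof.
  intros HG. unfold bracket, nabla.
  rewrite (dvec_wave G (reduced_derive G) alpha beta p _ (proj2 HG)
                 (fun x => reduced_derive_spec G x HG)).
  rewrite (dvec_swirl_field U U1 p _ (proj2 U_even_smooth) U_derive).
  unfold wave. rewrite radius_sqr.
  apply pt_ext; unfold vsub, swirl_field, px, py, pz; cbn [fst snd]; ring.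
Qed.

Definition pressure (k : R) (p : pt) : R := k * (axial (radius p) * cos (nu * pz p)).

Lemma scalar_field_pressure (k : R) : scalar_field (pressure k).
Proof.
  split.
  - apply (smooth_mult (fun _ : pt => k) (fun p : pt => axial (radius p) * cos (nu * pz p)));
      [apply smooth_const|].
    apply (smooth_mult (fun p : pt => axial (radius p)) (fun p : pt => cos (nu * pz p)));
      [apply smooth_radial, even_smooth_axial|].
    apply (smooth_comp cos (fun p : pt => nu * pz p) (proj1 smooth_cos_sin)).
    apply (smooth_mult (fun _ : pt => nu) (fun p : pt => pz p));
      [apply smooth_const | apply smooth_linear, is_linear_pz].
  - intros p p' _ Hp. unfold pressure, nu.
    destruct (cos_sin_same_pt n p p' Hp) as [-> _]. now rewrite (radius_same_pt p p' Hp).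
Qed.

Lemma grad_pressure (k : R) (p : pt) :
  grad (pressure k) p =
  (k * (px p * (Q (radius p) * chi (radius p)) * cos (nu * pz p)),
   k * (py p * (Q (radius p) * chi (radius p)) * cos (nu * pz p)),
   k * (axial (radius p) * (- nu * sin (nu * pz p)))).
Proof.
  assert (D : forall v, dirD (pressure k) p v =
    k * ((px p * px v + py p * py v) * (Q (radius p) * chi (radius p)) * cos (nu * pz p)
         + axial (radius p) * (nu * pz v * - sin (nu * pz p)))).
  { intros v. pose proof axial_even.
    set (h := fun x => Q x * chi x).
    assert (forall x, is_derive axial x (x * h x)) by exact axial_derive.
    apply dirD_unique.
    eapply (is_dirD_eq (fun q : pt => k * (axial (radius q) * cos (nu * pz q)))); [dir | unfold h; ring]. }
  unfold grad. rewrite !D.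
  apply pt_ext; unfold e_x, e_y, e_z, px, py, pz; cbn [fst snd]; ring.
Qed.

(** The three components explain the constants. Axially the left side is 0, so the pressure
    coefficient nu A / lambda^2 must balance -(nu/lambda)^2 A. Radially the centrifugal term -2 u
    omega nu A r chi cos(n z) then matches because Q - nu^2 = -2 lambda^2 u omega. Azimuthally, the
    radial velocity is multiplied by omega, which yields the swirl amplitude nu alpha. *)
Lemma linearized_euler_wave (alpha A : R) (p : pt) :
  vadd (nabla (swirl_field U) (wave vorticity alpha (nu * A)) p)
       (nabla (wave vorticity alpha (nu * A)) (swirl_field U) p) =
  vsub (grad (pressure (nu / lambda ^ 2 * A)) p)
       (wave vorticity (- (nu / lambda) ^ 2 * A) (nu * alpha) p).
Proof.
  unfold nabla.
  rewrite (dvec_wave vorticity (reduced_derive vorticity) _ _ p _ (proj2 even_smooth_vorticity)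
                 (fun x => reduced_derive_spec _ x even_smooth_vorticity)).
  rewrite (dvec_swirl_field U U1 p _ (proj2 U_even_smooth) U_derive).
  rewrite grad_pressure, Q_eq.
  assert (Hv : (px p ^ 2 + py p ^ 2) * U1 (radius p) = vorticity (radius p) - 2 * U (radius p))
    by (unfold vorticity; rewrite radius_sqr; ring).
  unfold vadd, vsub, wave, swirl_field.
  set (w := vorticity (radius p)) in *. clearbody w.
  set (u0 := U (radius p)) in *. set (u1 := U1 (radius p)) in *.
  set (C := chi (radius p)). set (H := axial (radius p)).
  set (K := kap (radius p)). set (c := cos _). set (s := sin _).
  (* With all profile values opaque, what remains is a rational identity in the coordinates. *)
  clearbody u0 u1 C H K c s.
  destruct p as [[x y] z]. unfold px, py, pz in *; cbn [fst snd] in *.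
  assert (Hw : w = (x ^ 2 + y ^ 2) * u1 + 2 * u0) by lra.
  apply pt_ext; unfold px, py, pz; cbn [fst snd]; rewrite Hw; field; exact lambda_nonzero.
Qed.

End Wave.

(** * The Jacobi field *)

(** [u] and its even reflection need agree only on nonnegative arguments; near r > 0 they coincide,
    hence so do their derivatives. *)
Lemma omega_eq_vorticity (u U1 : R -> R) (r : R) :
  (forall x, is_derive (fun x => u (Rabs x)) x (x * U1 x)) -> 0 < r ->
  omega u r = vorticity (fun x => u (Rabs x)) U1 r.
Proof.
  intros Hd Hr.
  assert (D : Derive u r = r * U1 r).
  { apply is_derive_unique.
    apply is_derive_ext_loc with (fun x => u (Rabs x)); [|apply Hd].
    exists (mkposreal r Hr). intros x Hx.
    change (Rabs (x - r) < r) in Hx. apply Rabs_def2 in Hx.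
    rewrite Rabs_pos_eq by lra. reflexivity. }
  unfold omega, vorticity. rewrite D, Rabs_pos_eq by lra. ring.
Qed.

Lemma sl_bessel_system (u U1 Q psi : R -> R) (n : nat) (lambda : R) :
  (forall x, is_derive (fun x => u (Rabs x)) x (x * U1 x)) ->
  (forall x, Q x = INR n ^ 2 - 2 * lambda ^ 2 * (u (Rabs x) * vorticity (fun x => u (Rabs x)) U1 x)) ->
  (forall r, 0 < r < 1 ->
     ex_derive psi r /\ ex_derive (fun s => s * Derive psi s) r /\
     / r * Derive (fun s => s * Derive psi s) r - (INR n ^ 2 + / r ^ 2) * psi r
     = - 2 * lambda ^ 2 * u r * omega u r * psi r) ->
  bessel_system Q psi (fun r => r * Derive psi r).
Proof.
  intros Hd HQ Hsl r Hr. destruct (Hsl r Hr) as [H1 [H2 H3]]. split.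
  - replace (r * Derive psi r / r) with (Derive psi r) by (field; lra).
    now apply Derive_correct.
  - replace ((r * Q r + / r) * psi r) with (Derive (fun s => s * Derive psi s) r);
      [now apply Derive_correct|].
    rewrite HQ, <- (omega_eq_vorticity u U1 r Hd (proj1 Hr)), Rabs_pos_eq by lra.
    set (D := Derive _ r) in *.
    replace D with (r * (/ r * D - (INR n ^ 2 + / r ^ 2) * psi r)
                    + r * (INR n ^ 2 + / r ^ 2) * psi r) by (field; lra).
    rewrite H3. field. lra.
Qed.

(** Serves to carry a nonzero value of Y at a chosen point over to the Jacobi field Y o eta. A lift
    reaches that point only up to a period in z. *)
Lemma diffeo_surjective (F : pt -> pt) (p : pt) :
  diffeo F -> in_M p -> exists q, in_M q /\ same_pt p (F q).
Proof.
  intros [_ [G [[_ [HG _]] H]]] Hp.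
  exists (G p). destruct (H p Hp) as [[Hx [Hy [k Hk]]] _].
  split; [now apply HG|].
  split; [now symmetry|]. split; [now symmetry|].
  exists (- k)%Z. rewrite opp_IZR. lra.
Qed.

Lemma smooth_trig (c : R) : smooth (fun t => cos (c * t)) /\ smooth (fun t => sin (c * t)).
Proof.
  assert (H : smooth (fun t : R => c * t))
    by (apply (smooth_mult (U := R_NormedModule) (fun _ => c) (fun t => t)); [apply smooth_const | apply smooth_id]).
  split; [exact (smooth_comp cos _ (proj1 smooth_cos_sin) H) | exact (smooth_comp sin _ (proj2 smooth_cos_sin) H)].
Qed.

Theorem theorem5
  (u : R -> R)
  (u_smooth : smooth u)
  (X_field : vector_field (swirl u))
  (u_omega_pos : forall r, 0 <= r <= 1 -> u r * omega u r > 0)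
  (eta : R -> pt -> pt)
  (eta_geodesic : geodesic eta)
  (eta_0 : forall p, in_M p -> same_pt (eta 0 p) p)
  (eta_velocity_0 : forall p, in_M p -> dt eta 0 p = swirl u p)
  (n : nat) (n_pos : (1 <= n)%nat)
  (lambda : R) (lambda_eigenvalue : sl_eigenvalue u n lambda) :
  monoconjugate (swirl u) eta (2 * PI * lambda / INR n).
Proof.
  rewrite swirl_eq.
  assert (HU := even_smooth_swirl_profile u u_smooth X_field).
  set (U := fun x => u (Rabs x)) in *.
  set (U1 := reduced_derive U).
  assert (HU1 : even_smooth U1) by now apply even_smooth_reduced_derive.
  assert (HUd : forall x, is_derive U x (x * U1 x)) by (intros x; now apply reduced_derive_spec).
  set (om := vorticity U U1).
  assert (Hom : even_smooth om) by now apply even_smooth_vorticity.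
  set (nu := INR n).
  assert (Hnu : 0 < nu) by (apply lt_0_INR; lia).
  set (Q := fun x => nu ^ 2 - 2 * lambda ^ 2 * (U x * om x)).
  assert (HQ : even_smooth Q).
  { assert (H : even_smooth (fun x => nu ^ 2 + (- (2 * lambda ^ 2)) * (U x * om x))).
    { apply even_smooth_plus; [apply even_smooth_const|].
      apply even_smooth_mult; [apply even_smooth_const | now apply even_smooth_mult]. }
    replace Q with (fun x => nu ^ 2 + (- (2 * lambda ^ 2)) * (U x * om x)); [exact H|].
    apply functional_extensionality. intros x. unfold Q. ring. }
  set (chi := regular_solution Q).
  assert (Hchi : even_smooth chi) by now apply even_smooth_regular_solution.
  set (g := fun x => Q x * chi x).
  assert (Hg : even_smooth g) by now apply even_smooth_mult.
  set (kap := avg 3 g). set (kap' := avg 4 (Derive g)).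
  assert (Hkap : even_smooth kap) by now apply even_smooth_avg.
  assert (Dchi : forall x, is_derive chi x (x * kap x))
    by exact (is_derive_regular_solution Q HQ).
  assert (Dg : forall x, is_derive g x (Derive g x))
    by (intros x; apply smooth_R_derive, Hg).
  assert (Cg : forall x, continuous (Derive g) x)
    by (intros x; apply (smooth_R_continuous (Derive g)), smooth_Derive, Hg).
  assert (Dkap : forall x, is_derive kap x (kap' x))
    by (intros x; now apply is_derive_avg).
  (* Integration by parts with weight 3: the coefficient 4 is [INR (S 3)]. *)
  assert (Ode : forall x, 4 * kap x + x * kap' x = Q x * chi x).
  { intros x. change (Q x * chi x) with (g x). rewrite <- (avg_by_parts 3 g (Derive g) x Dg Cg).
    unfold kap, kap'. simpl INR. ring. }
  assert (chi_0 : chi 0 = 1) by now apply regular_solution_0.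
  assert (chi_1 : chi 1 = 0).
  { destruct lambda_eigenvalue as [psi [Hsl [H1 [Hl1 [Hl0 Hne]]]]].
    apply (regular_solution_vanishes_at_1 Q chi kap kap') with psi (fun r => r * Derive psi r);
      try assumption.
    - intros x. apply (smooth_R_continuous Q), HQ.
    - exact (sl_bessel_system u U1 Q psi n lambda HUd (fun x => eq_refl) Hsl). }
  assert (Hlam : lambda <> 0).
  { intros E. assert (H : 1 <= chi 1); [|lra].
    apply regular_solution_ge_1; [exact HQ|].
    intros y. unfold Q. rewrite E. generalize (pow2_ge_0 nu). lra. }
  set (c := nu / lambda).
  assert (Hc : c <> 0) by (unfold c; apply Rmult_integral_contrapositive_currified; [lra | now apply Rinv_neq_0_compat]).
  set (t0 := 2 * PI * lambda / nu).
  assert (Hct0 : c * t0 = 2 * PI) by (unfold c, t0; field; lra).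
  (* [A] and [B] are the successive primitives of [a] that vanish at 0. Both vanish again at [t0],
     since c t0 = 2 pi and cos(c t) has zero mean over a period. *)
  set (A := fun t => sin (c * t) / c).
  set (a := fun t => cos (c * t)).
  set (B := fun t => (1 - cos (c * t)) / c ^ 2).
  assert (DA : forall t, is_derive A t (a t)) by (intros t; unfold A, a; auto_derive; [easy | field; exact Hc]).
  assert (DB : forall t, is_derive B t (A t)) by (intros t; unfold B, A; auto_derive; [easy | field; exact Hc]).
  assert (Da : forall t, is_derive a t (- c ^ 2 * A t)) by (intros t; unfold a, A; auto_derive; [easy | field; exact Hc]).
  assert (SB : smooth B).
  { apply smooth_R_intro with A; [exact DB|]. apply smooth_R_intro with a; [exact DA|].
    exact (proj1 (smooth_trig c)). }
  assert (SA : smooth A) by (apply smooth_R_intro with a; [exact DA | exact (proj1 (smooth_trig c))]).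
  assert (Sa : smooth a) by exact (proj1 (smooth_trig c)).
  (* In Y' + [X, Y] = Z the swirl parts read beta' u + nu A r^2 [U1] = nu A (2u + r^2 [U1]), whence
     beta' = 2 nu A and beta = 2 nu B. *)
  set (Y := fun t => wave n chi kap U (A t) (2 * nu * B t)).
  set (Z := fun t => wave n chi kap om (a t) (nu * A t)).
  assert (TY : forall t, tangent_id (Y t)) by (intros t; now apply tangent_id_wave with Q kap').
  assert (TZ : forall t, tangent_id (Z t)) by (intros t; now apply tangent_id_wave with Q kap').
  assert (Y_0 : forall t p, A t = 0 -> B t = 0 -> Y t p = vzero).
  { intros t p HA HB. unfold Y, wave. rewrite HA, HB.
    apply pt_ext; unfold vzero, px, py, pz; cbn [fst snd]; ring. }
  destruct eta_geodesic as [_ [Heta _]].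
  split.
  { unfold t0. apply Rmult_integral_contrapositive_currified;
      [|apply Rinv_neq_0_compat; fold nu; lra].
    apply Rmult_integral_contrapositive_currified; [generalize PI_RGT_0; lra | exact Hlam]. }
  exists (fun t p => Y t (eta t p)).
  split; [|split; [|split]].
  - exists Y, Z.
    split; [|split; [|split; [|split; [|split; [|split]]]]]; try assumption.
    + apply (smooth_curve_wave n chi kap Hchi Hkap U A (fun t => 2 * nu * B t)); try assumption.
      apply (smooth_mult (U := R_NormedModule) (fun _ => 2 * nu) B); [apply smooth_const | exact SB].
    + apply (smooth_curve_wave n chi kap Hchi Hkap om a (fun t => nu * A t)); try assumption.
      apply (smooth_mult (U := R_NormedModule) (fun _ => nu) A); [apply smooth_const | exact SA].
    + intros t p _. unfold Y at 1.
      rewrite (dt_wave n chi kap U A (fun t => 2 * nu * B t) a (fun t => 2 * nu * A t) t p (DA t));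
        [|now apply (is_derive_scal B)].
      unfold Y. rewrite (bracket_swirl_wave n Q chi kap kap') with (U1 := U1); try assumption.
      unfold Z, om, vorticity, wave. fold nu.
      apply pt_ext; unfold vadd, px, py, pz; cbn [fst snd]; ring.
    + intros t.
      set (V := fun p => vadd (nabla (swirl_field U) (Z t) p) (nabla (Z t) (swirl_field U) p)).
      set (q := pressure n chi kap (nu / lambda ^ 2 * A t)).
      set (Zt := wave n chi kap om (- c ^ 2 * A t) (nu * a t)).
      assert (TZt : tangent_id Zt) by now apply tangent_id_wave with Q kap'.
      assert (Hq : scalar_field q) by now apply scalar_field_pressure.
      (* Since [Zt] is divergence-free and tangent to the boundary, this decomposition shows that
         [q] solves the Neumann problem for [V] and that P(V) = -[Zt], where [Zt] is the time
         derivative of Z. *)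
      assert (HV : V = fun p => vsub (grad q p) (Zt p)).
      { apply functional_extensionality. intros p.
        exact (linearized_euler_wave n Q chi kap kap' Hchi Hkap Dchi Dkap Ode U U1 lambda
                 HU HU1 HUd Hlam (fun _ => eq_refl) (a t) (A t) p). }
      exists (fun p => vsub (V p) (grad q p)). split.
      * exists q. split; [exact Hq|]. split; [|split].
        -- intros p Hp. change (laplacian q p = divergence V p). rewrite HV, divergence_vsub.
           ++ rewrite (proj1 (proj2 TZt) p Hp). unfold laplacian. ring.
           ++ apply smooth_map_grad, Hq.
           ++ apply TZt.
        -- intros p Hp. change (dot (grad q p) (normal p) = dot (V p) (normal p)).
           assert (HB := proj1 (proj2 (proj2 TZt)) p Hp).
           rewrite HV. unfold dot, vsub in *. unfold px, py, pz in *. cbn [fst snd] in *. lra.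
        -- reflexivity.
      * intros p _. unfold Z at 1.
        rewrite (dt_wave n chi kap om a (fun t => nu * A t) (fun t => - c ^ 2 * A t) (fun t => nu * a t) t p (Da t));
          [|now apply (is_derive_scal A)].
        fold Zt. rewrite HV.
        apply pt_ext; unfold vadd, vsub, vzero, px, py, pz; cbn [fst snd]; ring.
    + reflexivity.
  (* At a quarter period sin(c t) = 1, and at this point of the axis sin(nu z) = 1. The vertical
     component of Y there is [axial 0] / c = 2/c, because chi(0) = 1. *)
  - set (t := t0 / 4). set (p := (0, 0, PI / (2 * nu)) : pt).
    assert (Hp : in_M p) by (unfold in_M, p, px, py; simpl; lra).
    destruct (diffeo_surjective (eta t) p (proj1 (Heta t)) Hp) as [p' [Hp' Hpp']].
    exists t, p'. split; [exact Hp'|].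
    (* Periodicity of Y in z replaces the image of [p'] by [p]. *)
    rewrite (proj2 (proj1 (TY t)) p (eta t p') Hp Hpp').
    intros E. apply (f_equal pz) in E. unfold Y, wave, vzero, pz, p in E. cbn [fst snd] in E.
    assert (Hr : radius (0, 0, PI / (2 * nu)) = 0).
    { unfold radius, px, py; simpl. rewrite Rmult_0_l, Rplus_0_r. apply sqrt_0. }
    rewrite Hr in E. fold nu in E. unfold axial in E. rewrite chi_0 in E.
    replace (nu * (PI / (2 * nu))) with (PI / 2) in E by (field; lra).
    unfold A, t in E. replace (c * (t0 / 4)) with (PI / 2) in E by lra.
    rewrite sin_PI2 in E.
    assert (Hinv := Rinv_neq_0_compat c Hc).
    apply Hinv. unfold Rdiv in E. lra.
  - intros p _. apply Y_0; unfold A, B; rewrite Rmult_0_r, ?sin_0, ?cos_0; field; exact Hc.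
  - intros p _. fold nu. fold t0.
    apply Y_0; unfold A, B; rewrite Hct0, ?sin_2PI, ?cos_2PI; field; exact Hc.
Qed.
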